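(* Let $\mathcal{U}$ be a universe. Then $\mathcal{U}$ is reduced if and only if all of the following hold: (1) if $1\in\hat{\mathcal{U}}$, then some Left end in $\mathcal{U}$ is a disintegrator; (2) some Left end in $\mathcal{U}$ is a starkiller; (3) if $\{\dagger,0\mid 0\}\in\hat{\mathcal{U}}$, then some Left end in $\mathcal{U}$ is a super starkiller; (4) $\{\dagger,0\mid\cdot\}\notin\hat{\mathcal{U}}$; and (5) $\{\dagger,0\mid 0,\dagger\}\notin\hat{\mathcal{U}}$.
   Context: Games are short partizan game forms under the misère convention (a player unable to move wins); $+$ is the disjunctive sum; $o_L(G)$ (resp. $o_R(G)$) $\in\{\mathscr{L},\mathscr{R}\}$ is the winner when Left (resp. Right) moves first; outcome classes are ordered $\mathscr{L}>\mathscr{N}>\mathscr{R}$, $\mathscr{L}>\mathscr{P}>\mathscr{R}$. For a set of games $\mathcal{A}$, $G\geq_{\mathcal{A}}H$ iff $o(G+X)\geq o(H+X)$ for all $X\in\mathcal{A}$; $\equiv_{\mathcal{A}}$ means both directions. A Left end is a game with no Left options; $0=\{\cdot\mid\cdot\}$, $1=\{0\mid\cdot\}$. Augmented forms (Siegel) are game forms where each subposition may carry a Left and/or Right tombstone, written $\dagger$ among the Left/Right entries (e.g. $\{\dagger,0\mid 0\}$ has Left option $0$, a Left tombstone, and Right option $0$); tombstones are markers, not options; a player to move on a position with no options for them or carrying their tombstone wins immediately. A universe is a set $\mathcal{U}$ of games closed under sums, conjugates, options, and formation of $\{\mathscr{G}\mid\mathscr{H}\}$ for finite non-empty $\mathscr{G},\mathscr{H}\subseteq\mathcal{U}$.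 $\hat{\mathcal{U}}$ is the set of augmented forms admitting a $\mathcal{U}$-expansion (tombstones can be replaced by $\mathcal{U}$-end-reversible options in $\mathcal{U}$ to recover a game form in $\mathcal{U}$). $\mathcal{U}$ is reduced if every $\mathcal{U}$-invertible $G\in\mathcal{U}$ (i.e. $G+H\equiv_{\mathcal{U}}0$ for some $H\in\mathcal{U}$) satisfies $G\equiv_{\mathcal{U}}0$. Disintegrator: a game with a Right option $G^R$ that is not a Left end such that each Left option $G^{RL}$ of $G^R$ has $o_L(G^{RL})=\mathscr{R}$ or is a disintegrator. Starkiller: a game with a Right option $G^R$ with $o_R(G^R)=\mathscr{R}$ such that each $G^{RL}$ has $o_L(G^{RL})=\mathscr{R}$ or is a starkiller. Super starkiller: a game with a Right option $G^R$ that is not a Left end, with $o_R(G^R)=\mathscr{R}$, such that each $G^{RL}$ has $o_L(G^{RL})=\mathscr{R}$ or is a super starkiller. *)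

(* Defs.v *)
From Stdlib Require List.
From HB Require Import structures.
From mathcomp Require Import all_boot.

Set Implicit Arguments.
Unset Strict Implicit.
Unset Printing Implicit Defensive.

(* Options are kept in lists. A set of game forms is therefore a predicate on
   [game] that is invariant under [same_form] (see [universe]), which forgets
   the order and the repetition of options, hereditarily. *)
Inductive game : Type := Game (lefts rights : seq game).

Definition lopts (G : game) : seq game := let: Game L _ := G in L.
Definition ropts (G : game) : seq game := let: Game _ R := G in R.

Fixpoint game_encode (G : game) : GenTree.tree void :=
  let: Game L R := G in
  GenTree.Node (size L) (map game_encode L ++ map game_encode R).

Fixpoint game_decode (t : GenTree.tree void) : game :=
  match t with
  | GenTree.Leaf _ => Game [::] [::]
  | GenTree.Node n ts =>
      Game (take n (map game_decode ts)) (drop n (map game_decode ts))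
  end.

Lemma game_encodeK : cancel game_encode game_decode.
Proof.
rewrite /cancel; fix IH 1; case=> L R /=; rewrite map_cat.
have -> : map game_decode (map game_encode L) = L.
  by elim: L => //= g L ->; rewrite IH.
have -> : map game_decode (map game_encode R) = R.
  by elim: R => //= g R ->; rewrite IH.
by rewrite take_size_cat // drop_size_cat.
Qed.

HB.instance Definition _ := Equality.copy game (can_type game_encodeK).

Fixpoint same_form (G H : game) {struct G} : bool :=
  let: Game LG RG := G in
  let: Game LH RH := H in
  [&& all (fun g => has (fun h => same_form g h) LH) LG,
      all (fun h => has (fun g => same_form g h) LG) LH,
      all (fun g => has (fun h => same_form g h) RH) RG &
      all (fun h => has (fun g => same_form g h) RG) RH].

Definition game0 : game := Game [::] [::].
Definition game1 : game := Game [:: game0] [::].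

Definition left_end (G : game) : bool := lopts G == [::].
Definition right_end (G : game) : bool := ropts G == [::].

Fixpoint game_conj (G : game) : game :=
  let: Game L R := G in Game (map game_conj R) (map game_conj L).

Fixpoint game_add (G : game) : game -> game :=
  fix addG (H : game) : game :=
    match G, H with
    | Game LG RG, Game LH RH =>
        Game ([seq game_add g H | g <- LG] ++ [seq addG h | h <- LH])
             ([seq game_add g H | g <- RG] ++ [seq addG h | h <- RH])
    end.

Inductive player : Type := Left | Right.

Definition is_Left (p : player) : bool := if p is Left then true else false.

Lemma is_LeftK : cancel is_Left (fun b : bool => if b then Left else Right).
Proof. by case. Qed.

HB.instance Definition _ := Equality.copy player (can_type is_LeftK).

(* [winner G p] wins [G] when [p] moves first; a player who cannot move wins. *)
Fixpoint winner (G : game) (p : player) {struct G} : player :=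
  let: Game L R := G in
  match p with
  | Left =>
      if nilp L || has (fun g => winner g Right == Left) L then Left else Right
  | Right =>
      if nilp R || has (fun g => winner g Left == Right) R then Right else Left
  end.

Definition oL (G : game) : player := winner G Left.
Definition oR (G : game) : player := winner G Right.

Inductive outcome_class : Type := OutL | OutN | OutP | OutR.

Definition outcome (G : game) : outcome_class :=
  match oL G, oR G with
  | Left, Left => OutL
  | Left, Right => OutN
  | Right, Left => OutP
  | Right, Right => OutR
  end.

Definition outcome_le (a b : outcome_class) : bool :=
  match a, b with
  | OutR, _ | _, OutL | OutN, OutN | OutP, OutP => true
  | _, _ => false
  end.

Definition game_ge (A : game -> Prop) (G H : game) : Prop :=
  forall X, A X -> outcome_le (outcome (game_add H X)) (outcome (game_add G X)).

Definition game_equiv (A : game -> Prop) (G H : game) : Prop :=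
  game_ge A G H /\ game_ge A H G.

Record universe (U : game -> Prop) : Prop := Universe {
  universe_same_form : forall G H, same_form G H -> U G -> U H;
  universe_nonempty : exists G, U G;
  universe_add : forall G H, U G -> U H -> U (game_add G H);
  universe_conjugate : forall G, U G -> U (game_conj G);
  universe_lopts : forall G g, U G -> g \in lopts G -> U g;
  universe_ropts : forall G g, U G -> g \in ropts G -> U g;
  universe_dicotic : forall L R : seq game,
    L != [::] -> R != [::] ->
    (forall g, g \in L -> U g) -> (forall g, g \in R -> U g) -> U (Game L R)
}.

Definition game_invertible (U : game -> Prop) (G : game) : Prop :=
  exists H, U H /\ game_equiv U (game_add G H) game0.

Definition reduced (U : game -> Prop) : Prop :=
  forall G, U G -> game_invertible U G -> game_equiv U G game0.

(* The booleans record the presence of a Left and of a Right tombstone. *)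
Inductive aform : Type :=
  AForm (ltomb : bool) (lefts rights : seq aform) (rtomb : bool).

Fixpoint aform_of (G : game) : aform :=
  let: Game L R := G in AForm false (map aform_of L) (map aform_of R) false.

Definition left_end_reversible (U : game -> Prop) (G E : game) : Prop :=
  exists K, [/\ K \in ropts E, left_end K & game_ge U G K].

Definition right_end_reversible (U : game -> Prop) (G E : game) : Prop :=
  exists K, [/\ K \in lopts E, right_end K & game_ge U K G].

(* [expansion U A G]: the game form [G] arises from [A] by replacing, in every
   subposition, each tombstone by one or more options that are end-reversible
   in the resulting form; [EL] and [ER] are these replacements. *)
Inductive expansion (U : game -> Prop) : aform -> game -> Prop :=
| Expansion (lt rt : bool) (LA RA : seq aform) (L R EL ER : seq game) :
    List.Forall2 (expansion U) LA L ->
    List.Forall2 (expansion U) RA R ->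
    lt = (EL != [::]) ->
    rt = (ER != [::]) ->
    (forall E, E \in EL -> left_end_reversible U (Game (L ++ EL) (R ++ ER)) E) ->
    (forall E, E \in ER -> right_end_reversible U (Game (L ++ EL) (R ++ ER)) E) ->
    expansion U (AForm lt LA RA rt) (Game (L ++ EL) (R ++ ER)).

Definition hat (U : game -> Prop) (A : aform) : Prop :=
  exists G, U G /\ expansion U A G.

Inductive disintegrator (G : game) : Prop :=
| Disintegrator (GR : game) :
    GR \in ropts G ->
    ~~ left_end GR ->
    (forall GRL, GRL \in lopts GR -> oL GRL = Right \/ disintegrator GRL) ->
    disintegrator G.

Inductive starkiller (G : game) : Prop :=
| Starkiller (GR : game) :
    GR \in ropts G ->
    oR GR = Right ->
    (forall GRL, GRL \in lopts GR -> oL GRL = Right \/ starkiller GRL) ->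
    starkiller G.

Inductive super_starkiller (G : game) : Prop :=
| SuperStarkiller (GR : game) :
    GR \in ropts G ->
    ~~ left_end GR ->
    oR GR = Right ->
    (forall GRL, GRL \in lopts GR -> oL GRL = Right \/ super_starkiller GRL) ->
    super_starkiller G.

(* Main.v *)
(* Write [ge] for comparison modulo [U], and call a Left option reversible when it
   has a Right response below the game. If [G + H] is equivalent to 0, then
   nonreversible Left options of [G] (bypassing reversible ones) pair up with
   nonreversible Right options of [H]; going back and forth, finiteness forces some
   pair to sum to zero, so by induction on the size some nonreversible option is
   equivalent to 0 and all the others are dominated by it. Hence up to equivalence
   each side of [G] holds at most 0 and a tombstone, and a Left tombstone amounts to
   [G] being [Lstrong]: Left, moving first, wins [G + X] for every Left end [X] of
   [U]. Each possible shape other than 0 is refuted by a condition of the theorem.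
   Conversely, when a condition fails, an explicit expansion [G] of the
   corresponding form satisfies [G + conj G = 0] but is not equivalent to 0.

   A subtle case is a [G] equivalent to 1 while the form 1 itself is not in the
   universe: then the hypothesis on super starkillers is violated instead. *)
From Stdlib Require Import Classical.
Require Import Defs.
From mathcomp Require Import all_boot.
From mathcomp Require Import zify.

Set Implicit Arguments.
Unset Strict Implicit.
Unset Printing Implicit Defensive.

Declare Scope game_scope.
Local Open Scope game_scope.
Local Notation "G ⊕ H" := (game_add G H) (at level 50, left associativity) : game_scope.
Local Notation "0" := game0 : game_scope.
Local Notation conj := game_conj.

(** * Wins of Left moving first or second, sizes, and options of sums and conjugates *)

Definition lw1 (G : game) : bool := oL G == Left.
Definition lw2 (G : game) : bool := oR G == Left.

Fixpoint gsize (G : game) : nat :=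
  let: Game L R := G in (sumn (map gsize L) + sumn (map gsize R)).+1.

Lemma leq_sumn_map (s : seq game) g :
  g \in s -> (gsize g <= sumn (map gsize s))%N.
Proof.
elim: s => //= a s IH; rewrite inE => /orP [/eqP ->|/IH]; lia.
Qed.

Lemma gsize_lopt G g : g \in lopts G -> (gsize g < gsize G)%N.
Proof. by case: G => L R /= /leq_sumn_map; lia. Qed.

Lemma gsize_ropt G g : g \in ropts G -> (gsize g < gsize G)%N.
Proof. by case: G => L R /= /leq_sumn_map; lia. Qed.

Lemma game_ind_opts (P : game -> Prop) :
  (forall G, (forall g, g \in lopts G -> P g) ->
             (forall g, g \in ropts G -> P g) -> P G) ->
  forall G, P G.
Proof.
move=> step G; have [n] := ubnP (gsize G); elim: n G => // n IH G ltGn.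
by apply: step => g => [/gsize_lopt|/gsize_ropt] lt_g; apply: IH; lia.
Qed.

Lemma lopts_add G H :
  lopts (G ⊕ H) = [seq g ⊕ H | g <- lopts G] ++ [seq G ⊕ h | h <- lopts H].
Proof. by case: G => ? ?; case: H => ? ?. Qed.

Lemma ropts_add G H :
  ropts (G ⊕ H) = [seq g ⊕ H | g <- ropts G] ++ [seq G ⊕ h | h <- ropts H].
Proof. by case: G => ? ?; case: H => ? ?. Qed.

Lemma game_eq G H : lopts G = lopts H -> ropts G = ropts H -> G = H.
Proof. by case: G => ? ?; case: H => ? ? /= -> ->. Qed.

Lemma in_lopts_addl G H g : g \in lopts G -> g ⊕ H \in lopts (G ⊕ H).
Proof.
move=> g_in; rewrite lopts_add mem_cat; apply/orP; left.
exact: (map_f (game_add^~ H)).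
Qed.

Lemma in_lopts_addr G H h : h \in lopts H -> G ⊕ h \in lopts (G ⊕ H).
Proof.
move=> h_in; rewrite lopts_add mem_cat; apply/orP; right.
exact: (map_f (game_add G)).
Qed.

Lemma in_ropts_addl G H g : g \in ropts G -> g ⊕ H \in ropts (G ⊕ H).
Proof.
move=> g_in; rewrite ropts_add mem_cat; apply/orP; left.
exact: (map_f (game_add^~ H)).
Qed.

Lemma in_ropts_addr G H h : h \in ropts H -> G ⊕ h \in ropts (G ⊕ H).
Proof.
move=> h_in; rewrite ropts_add mem_cat; apply/orP; right.
exact: (map_f (game_add G)).
Qed.

Lemma lopts_addP G H x : x \in lopts (G ⊕ H) ->
  (exists2 g, g \in lopts G & x = g ⊕ H) \/
  (exists2 h, h \in lopts H & x = G ⊕ h).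
Proof.
by rewrite lopts_add mem_cat => /orP [] /mapP [y y_in ->]; [left|right]; exists y.
Qed.

Lemma ropts_addP G H x : x \in ropts (G ⊕ H) ->
  (exists2 g, g \in ropts G & x = g ⊕ H) \/
  (exists2 h, h \in ropts H & x = G ⊕ h).
Proof.
by rewrite ropts_add mem_cat => /orP [] /mapP [y y_in ->]; [left|right]; exists y.
Qed.

Lemma left_end_add G H : left_end (G ⊕ H) = left_end G && left_end H.
Proof. by case: G => [[|? ?] ?]; case: H => [[|? ?] ?]. Qed.

Lemma right_end_add G H : right_end (G ⊕ H) = right_end G && right_end H.
Proof. by case: G => [? [|? ?]]; case: H => [? [|? ?]]. Qed.

Lemma left_endP G g : left_end G -> g \in lopts G -> False.
Proof. by rewrite /left_end => /eqP ->. Qed.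

Lemma add0g G : 0 ⊕ G = G.
Proof.
elim/game_ind_opts: G => G IHl IHr.
by apply: game_eq; rewrite (lopts_add, ropts_add) /= -[RHS]map_id;
  apply/eq_in_map => g; [exact: IHl|exact: IHr].
Qed.

Lemma addg0 G : G ⊕ 0 = G.
Proof.
elim/game_ind_opts: G => G IHl IHr.
by apply: game_eq; rewrite (lopts_add, ropts_add) cats0 -[RHS]map_id;
  apply/eq_in_map => g; [exact: IHl|exact: IHr].
Qed.

Lemma addgA A B C : A ⊕ (B ⊕ C) = A ⊕ B ⊕ C.
Proof.
have [n] := ubnP (gsize A + gsize B + gsize C)%N.
elim: n A B C => // n IH A B C lt_n.
apply: game_eq; rewrite !(lopts_add, ropts_add) !map_cat -!map_comp -catA;
  congr (_ ++ (_ ++ _)); apply/eq_in_map => g g_in /=; apply: IH;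
  first [have := gsize_lopt g_in | have := gsize_ropt g_in]; lia.
Qed.

Lemma lopts_conj G : lopts (conj G) = map conj (ropts G).
Proof. by case: G. Qed.

Lemma ropts_conj G : ropts (conj G) = map conj (lopts G).
Proof. by case: G. Qed.

Lemma conjK : involutive conj.
Proof.
elim/game_ind_opts => G IHl IHr.
by apply: game_eq; rewrite !(lopts_conj, ropts_conj) -map_comp -[RHS]map_id;
  apply/eq_in_map => g; [exact: IHl|exact: IHr].
Qed.

Lemma conj_add G H : conj (G ⊕ H) = conj G ⊕ conj H.
Proof.
have [n] := ubnP (gsize G + gsize H)%N.
elim: n G H => // n IH G H lt_n.
apply: game_eq; rewrite !(lopts_add, ropts_add, lopts_conj, ropts_conj) map_cat;
  rewrite -!map_comp; congr (_ ++ _); apply/eq_in_map => g g_in /=; apply: IH;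
  first [have := gsize_lopt g_in | have := gsize_ropt g_in]; lia.
Qed.

Lemma left_end_conj G : left_end (conj G) = right_end G.
Proof. by case: G => [? [|? ?]]. Qed.

Lemma right_end_conj G : right_end (conj G) = left_end G.
Proof. by case: G => [[|? ?] ?]. Qed.

Lemma conj_lopt G g : g \in lopts G -> conj g \in ropts (conj G).
Proof. by rewrite ropts_conj; apply: map_f. Qed.

Lemma conj_ropt G g : g \in ropts G -> conj g \in lopts (conj G).
Proof. by rewrite lopts_conj; apply: map_f. Qed.

Lemma gsize_conj G : gsize (conj G) = gsize G.
Proof.
elim/game_ind_opts: G => -[L R] /= IHl IHr; rewrite addnC -!map_comp.
by congr (_ + _).+1; congr sumn; apply/eq_in_map.
Qed.

(** * How Left's wins unfold, and their behaviour under conjugation and reordering *)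

Lemma lw1P G : lw1 G <-> left_end G \/ exists2 g, g \in lopts G & lw2 g.
Proof.
case: G => L R; rewrite /lw1 /oL /left_end /lw2 /=.
case: ifP => [/orP [/nilP ->|/hasP [g g_in wg]]|/norP [nL /hasPn noL]]; split=> //.
- by left.
- by right; exists g.
- by case=> [/eqP E|[g /noL /negP]] //; move: nL; rewrite E.
Qed.

Lemma lw2P G : lw2 G <-> ~~ right_end G /\ forall g, g \in ropts G -> lw1 g.
Proof.
case: G => L R; rewrite /lw2 /oR /right_end /lw1 /oL /=.
case: ifP => [/orP [/nilP ->|/hasP [g g_in /eqP wg]]|].
- by split=> //; case.
- by split=> //; case=> _ /(_ g g_in); rewrite wg.
case/norP=> nR /hasPn noR; split=> // _; split; first by move: nR; case: (R).
by move=> g /noR; case: (winner g Left).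
Qed.

Lemma lw1_end G : left_end G -> lw1 G.
Proof. by move=> endG; apply/lw1P; left. Qed.

Lemma lw1_opt G g : g \in lopts G -> lw2 g -> lw1 G.
Proof. by move=> g_in wg; apply/lw1P; right; exists g. Qed.

Lemma lw2_opt G g : lw2 G -> g \in ropts G -> lw1 g.
Proof. by case/lw2P=> _; apply. Qed.

Lemma lw2_right_end G : right_end G -> ~~ lw2 G.
Proof. by move=> endG; apply/negP => /lw2P [/negP]. Qed.

Lemma Nlw2_opt G g : g \in ropts G -> ~~ lw1 g -> ~~ lw2 G.
Proof. by move=> g_in; apply: contra => /lw2_opt; apply. Qed.

Lemma Nlw1P G : ~~ left_end G -> (forall g, g \in lopts G -> ~~ lw2 g) -> ~~ lw1 G.
Proof. by move=> /negP nend wopts; apply/negP => /lw1P [//|[g /wopts /negP]]. Qed.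

Lemma lw12_conj G : lw1 (conj G) = ~~ lw2 G /\ lw2 (conj G) = ~~ lw1 G.
Proof.
elim/game_ind_opts: G => G IHl IHr; split; apply/idP/idP.
- case/lw1P=> [|[g]]; first by rewrite left_end_conj; apply: lw2_right_end.
  rewrite lopts_conj => /mapP [r r_in ->]; rewrite (IHr r r_in).2.
  exact: Nlw2_opt.
- move=> nw; apply/lw1P; rewrite left_end_conj.
  case: (boolP (right_end G)) => [|nend]; [by left|right; apply: NNPP => no].
  case/negP: nw; apply/lw2P; split=> // r r_in; case: (boolP (lw1 r)) => // nwr.
  by case: no; exists (conj r); rewrite ?conj_ropt // (IHr r r_in).2.
- case/lw2P; rewrite right_end_conj => nend wopts; apply: Nlw1P => // l l_in.
  by have := wopts _ (conj_lopt l_in); rewrite (IHl l l_in).1.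
- move=> nw; apply/lw2P; rewrite right_end_conj; split.
    by apply: contra nw; apply: lw1_end.
  move=> g; rewrite ropts_conj => /mapP [l l_in ->]; rewrite (IHl l l_in).1.
  by apply: contra nw; apply: lw1_opt.
Qed.

Lemma lw1_conj G : lw1 (conj G) = ~~ lw2 G. Proof. exact: (lw12_conj G).1. Qed.
Lemma lw2_conj G : lw2 (conj G) = ~~ lw1 G. Proof. exact: (lw12_conj G).2. Qed.


(** The two sums list their options in different orders, so [⊕] commutes only up to outcome. The
    third summand [C] makes the swap usable inside comparisons, where it is the test game. *)
Lemma lw_swap A B C :
  (lw1 (A ⊕ B ⊕ C) -> lw1 (B ⊕ A ⊕ C)) /\ (lw2 (A ⊕ B ⊕ C) -> lw2 (B ⊕ A ⊕ C)).
Proof.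
have [n] := ubnP (gsize A + gsize B + gsize C)%N.
elim: n A B C => // n IH A B C lt_n; split.
  case/lw1P; first by rewrite !left_end_add [_ && left_end B]andbC => ?;
    apply: lw1_end; rewrite !left_end_add.
  case=> x /lopts_addP [[y /lopts_addP [] [z z_in ->] ->]|[z z_in ->]];
    have lt_z := gsize_lopt z_in => w.
  - apply: (@lw1_opt _ (B ⊕ z ⊕ C)); first by rewrite in_lopts_addl ?in_lopts_addr.
    by apply: (IH _ _ _ _).2 w; lia.
  - apply: (@lw1_opt _ (z ⊕ A ⊕ C)); first by rewrite !in_lopts_addl.
    by apply: (IH _ _ _ _).2 w; lia.
  - apply: (@lw1_opt _ (B ⊕ A ⊕ z)); first by rewrite in_lopts_addr.
    by apply: (IH _ _ _ _).2 w; lia.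
case/lw2P; rewrite !right_end_add => nend w; apply/lw2P; split.
  by rewrite !right_end_add [_ && right_end A]andbC.
move=> x /ropts_addP [[y /ropts_addP [] [z z_in ->] ->]|[z z_in ->]];
  have lt_z := gsize_ropt z_in.
- apply: (IH _ _ _ _).1 (w (A ⊕ z ⊕ C) _); first lia.
  by rewrite in_ropts_addl ?in_ropts_addr.
- apply: (IH _ _ _ _).1 (w (z ⊕ B ⊕ C) _); first lia.
  by rewrite !in_ropts_addl.
- apply: (IH _ _ _ _).1 (w (A ⊕ B ⊕ z) _); first lia.
  by rewrite in_ropts_addr.
Qed.

Lemma lw1_swap A B C : lw1 (A ⊕ B ⊕ C) = lw1 (B ⊕ A ⊕ C).
Proof. by apply/idP/idP; apply: (lw_swap _ _ _).1. Qed.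

Lemma lw2_swap A B C : lw2 (A ⊕ B ⊕ C) = lw2 (B ⊕ A ⊕ C).
Proof. by apply/idP/idP; apply: (lw_swap _ _ _).2. Qed.

Lemma lw1C A B : lw1 (A ⊕ B) = lw1 (B ⊕ A).
Proof. by rewrite -[A ⊕ B]addg0 lw1_swap addg0. Qed.

Lemma lw2C A B : lw2 (A ⊕ B) = lw2 (B ⊕ A).
Proof. by rewrite -[A ⊕ B]addg0 lw2_swap addg0. Qed.
Lemma outcome_leE G H :
  outcome_le (outcome G) (outcome H) = (lw1 G ==> lw1 H) && (lw2 G ==> lw2 H).
Proof.
by rewrite /outcome /lw1 /lw2; case: (oL G); case: (oR G); case: (oL H); case: (oR H).
Qed.

(** * Finite selections, and the adjoint of a game *)

Lemma seq_neq0 (T : eqType) (s : seq T) : true = (s != [::]) -> exists x, x \in s.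
Proof. by case: s => // a s _; exists a; rewrite mem_head. Qed.

Lemma seq_filter (P : game -> Prop) (s : seq game) :
  exists t : seq game, forall g, g \in t <-> g \in s /\ P g.
Proof.
elim: s => [|a s [t IH]]; first by exists [::] => g; split=> // -[].
case: (classic (P a)) => Pa.
  exists (a :: t) => g; rewrite !inE; split.
    by case/orP=> [/eqP ->|/IH [gs Pg]]; rewrite ?eqxx ?gs ?orbT.
  by case=> /orP [-> //|gs] Pg; apply/orP; right; apply/IH.
exists t => g; rewrite inE; split; first by case/IH=> -> ?; rewrite orbT.
by case=> /orP [/eqP ->|gs] Pg //; apply/IH.
Qed.

Lemma seq_choice (P : game -> game -> Prop) (s : seq game) :
  (forall g, g \in s -> exists x, P g x) ->
  exists t : seq game, (forall g, g \in s -> exists2 x, x \in t & P g x) /\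
            (forall x, x \in t -> exists2 g, g \in s & P g x).
Proof.
elim: s => [|a s IH] ex; first by exists [::].
have [x Pax] := ex a (mem_head _ _).
have [|t [t1 t2]] := IH; first by move=> g gs; apply: ex; rewrite inE gs orbT.
exists (x :: t); split=> y; rewrite inE => /orP [/eqP ->|].
- by exists x; rewrite ?mem_head.
- by case/t1=> z zt Pz; exists z; rewrite // inE zt orbT.
- by exists a; rewrite ?mem_head.
- by case/t2=> z zt Pz; exists z; rewrite // inE zt orbT.
Qed.

(** The adjoint of misère theory: a conjugate in which a missing set of options becomes 0. The
    second player wins [G ⊕ adj G], and the adjoint lies in every universe, whatever [G] is. *)
Fixpoint adj (G : game) : game :=
  let: Game L R := G in
  Game (if R is [::] then [:: 0] else map adj R)
       (if L is [::] then [:: 0] else map adj L).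

Lemma adj_lopt G l : l \in lopts G -> adj l \in ropts (adj G).
Proof. by case: G => [[|a L] R] // l_in; apply: (map_f adj l_in). Qed.

Lemma conj_adj G : conj (adj G) = adj (conj G).
Proof.
elim/game_ind_opts: G => -[L R] /= IHl IHr; congr Game.
  case: L IHl => // a L IHl; rewrite -map_comp -[RHS]map_comp.
  exact/eq_in_map.
case: R IHr => // a R IHr; rewrite -map_comp -[RHS]map_comp.
exact/eq_in_map.
Qed.

Lemma Nlw1_adj G : ~~ lw1 (G ⊕ adj G).
Proof.
elim/game_ind_opts: G => G IHl IHr; apply: Nlw1P.
  by rewrite left_end_add negb_and; case: G {IHl IHr} => L [|? ?]; rewrite orbT.
move=> x /lopts_addP [] [y y_in ->].
  by apply: (Nlw2_opt (in_ropts_addr y (adj_lopt y_in))); apply: IHl.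
(* If [G] has no Right options, the move to the added 0 leaves Right without a move, hence
   winning. *)
case: (boolP (right_end G)) => endG.
  have -> : y = 0 by case: G endG y_in {IHl IHr} => L [|? ?] //= _; rewrite inE => /eqP.
  by rewrite addg0; apply: lw2_right_end.
have [r r_in ->] : exists2 r, r \in ropts G & y = adj r.
  by case: G endG y_in {IHl IHr} => L [|a R] // _ y_in; apply/mapP.
by apply: (Nlw2_opt (in_ropts_addl _ r_in)); apply: IHr.
Qed.

Lemma lw2_adj G : lw2 (G ⊕ adj G).
Proof.
by rewrite -[lw2 _]negbK -lw1_conj conj_add conj_adj; apply: Nlw1_adj.
Qed.

(** * The order modulo a universe *)

Section Universe.

Variables (U : game -> Prop) (hU : universe U).

Lemma U0 : U 0.
Proof.
have [G UG] := universe_nonempty hU.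
elim/game_ind_opts: G UG => -[[|a L] [|b R]] // IHl IHr UG.
- by apply: (IHr b); rewrite ?mem_head //; apply: (universe_ropts hU UG); rewrite mem_head.
- by apply: (IHl a); rewrite ?mem_head //; apply: (universe_lopts hU UG); rewrite mem_head.
- by apply: (IHl a); rewrite ?mem_head //; apply: (universe_lopts hU UG); rewrite mem_head.
Qed.
Hint Resolve U0 : core.

Let UD := universe_add hU.
Let UC := universe_conjugate hU.
Let Ul G g : U G -> g \in lopts G -> U g := universe_lopts hU (G := G) (g := g).
Let Ur G g : U G -> g \in ropts G -> U g := universe_ropts hU (G := G) (g := g).
Let Udic := universe_dicotic hU.
Hint Resolve UD UC : core.

Lemma U_adj G : U (adj G).
Proof.
elim/game_ind_opts: G => -[L R] /= IHl IHr; apply: Udic; try by case: L IHl; case: R IHr.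
  by case: R IHr => [_|a R IHr] g; [rewrite inE => /eqP ->|case/mapP=> r ? ->; apply: IHr].
by case: L IHl => [_|a L IHl] g; [rewrite inE => /eqP ->|case/mapP=> r ? ->; apply: IHl].
Qed.
Hint Resolve U_adj : core.

Definition ge (G H : game) : Prop :=
  forall X, U X -> (lw1 (H ⊕ X) -> lw1 (G ⊕ X)) /\ (lw2 (H ⊕ X) -> lw2 (G ⊕ X)).

Lemma game_geE G H : game_ge U G H <-> ge G H.
Proof.
split=> geGH X UX; have := geGH X UX; rewrite outcome_leE.
  by case/andP=> /implyP ? /implyP ?.
by case=> ? ?; apply/andP; split; apply/implyP.
Qed.

Lemma ge_refl G : ge G G. Proof. by []. Qed.
Hint Resolve ge_refl : core.

Lemma ge_trans G H K : ge G H -> ge H K -> ge G K.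
Proof.
move=> GH HK X UX; have [? ?] := GH X UX; have [? ?] := HK X UX.
by split; auto.
Qed.

Lemma ge_lw1 G H X : ge G H -> U X -> lw1 (H ⊕ X) -> lw1 (G ⊕ X).
Proof. by move=> GH /GH []. Qed.

Lemma ge_lw2 G H X : ge G H -> U X -> lw2 (H ⊕ X) -> lw2 (G ⊕ X).
Proof. by move=> GH /GH []. Qed.

Lemma ge_addr G H J : U J -> ge G H -> ge (G ⊕ J) (H ⊕ J).
Proof.
by move=> UJ GH X UX; rewrite -!addgA; apply: GH; apply: UD.
Qed.

Lemma geC A B : ge (A ⊕ B) (B ⊕ A).
Proof. by move=> X UX; rewrite lw1_swap lw2_swap. Qed.

Lemma geAC A B C : ge (A ⊕ B ⊕ C) (A ⊕ C ⊕ B).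
Proof.
move=> X UX; rewrite -!addgA !(lw1C A) !(lw2C A) !addgA -!(addgA _ X A).
by rewrite (lw1_swap B C) (lw2_swap B C).
Qed.

Lemma ge_addl G H J : U J -> ge G H -> ge (J ⊕ G) (J ⊕ H).
Proof.
move=> UJ GH; apply: ge_trans (geC _ _) _; apply: ge_trans (geC _ _).
exact: ge_addr.
Qed.

Lemma ge_add G H G' H' : U G -> U H' -> ge G H -> ge G' H' -> ge (G ⊕ G') (H ⊕ H').
Proof.
move=> UG UH' GH GH'; apply: ge_trans (ge_addl UG GH') _; exact: ge_addr.
Qed.

Lemma ge_add_ge0 G H : U G -> ge G 0 -> ge H 0 -> ge (G ⊕ H) 0.
Proof. by move=> UG G0 H0; rewrite -[X in ge _ X]addg0; apply: ge_add. Qed.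

Lemma ge_conj G H : ge G H -> ge (conj H) (conj G).
Proof.
move=> GH X UX; have [h1 h2] := GH _ (UC UX).
split; rewrite -[X]conjK -!conj_add ?(lw1_conj, lw2_conj); exact: contra.
Qed.

Definition Lstrong G := forall X, U X -> left_end X -> lw1 (G ⊕ X).

Lemma Lstrong_ge G H : ge G H -> Lstrong H -> Lstrong G.
Proof. by move=> GH sH X UX eX; apply: ge_lw1 (sH X UX eX). Qed.

Lemma Lstrong_end G : left_end G -> Lstrong G.
Proof. by move=> eG X _ eX; apply: lw1_end; rewrite left_end_add eG. Qed.

Lemma Nlw2_Rstrong G X : Lstrong (conj G) -> U X -> right_end X -> ~~ lw2 (G ⊕ X).
Proof.
move=> sG UX eX; rewrite -lw1_conj conj_add; apply: sG; first exact: UC.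
by rewrite left_end_conj.
Qed.

(* [G] and [H] need not belong to [U]. *)
Lemma ge_suff G H :
  (forall r, r \in ropts G ->
     (exists2 s, s \in ropts H & ge r s) \/ (exists2 l, l \in lopts r & ge l H)) ->
  (forall l, l \in lopts H ->
     (exists2 k, k \in lopts G & ge k l) \/ (exists2 r, r \in ropts l & ge G r)) ->
  (left_end H -> Lstrong G) ->
  (right_end G -> Lstrong (conj H)) ->
  ge G H.
Proof.
move=> mR mL pL pR; elim/game_ind_opts => X IHl IHr UX; split.
  case/lw1P; first by rewrite left_end_add => /andP [/pL sG eX]; apply: sG.
  case=> x /lopts_addP [] [y y_in ->] w.
    case: (mL y y_in) => [[k k_in ky]|[r r_in Gr]].
      by apply: (lw1_opt (in_lopts_addl X k_in)); apply: ge_lw2 w.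
    by apply: (ge_lw1 Gr UX); apply: (lw2_opt w); apply: in_ropts_addl.
  apply: (lw1_opt (in_lopts_addr G y_in)).
  exact: (IHl y y_in (Ul UX y_in)).2.
case/lw2P=> nend w; apply/lw2P; split.
  rewrite right_end_add; apply/negP => /andP [/pR sH eX].
  have /negP [] := Nlw2_Rstrong sH UX eX.
  by apply/lw2P.
move=> x /ropts_addP [] [y y_in ->].
  case: (mR y y_in) => [[s s_in ys]|[l l_in lH]].
    by apply: (ge_lw1 ys UX); apply: w; apply: in_ropts_addl.
  apply: (lw1_opt (in_lopts_addl X l_in)); apply: (ge_lw2 lH UX).
  exact/lw2P.
apply: (IHr y y_in (Ur UX y_in)).1; apply: w; exact: in_ropts_addr.
Qed.

(** * Separating games and the maintenance property *)

Lemma nge_lw1 G H : ~ ge G H -> exists X, [/\ U X, ~~ lw1 (G ⊕ X) & lw1 (H ⊕ X)].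
Proof.
move=> nge; apply: NNPP => no; apply: nge => X UX.
have step1 : lw1 (H ⊕ X) -> lw1 (G ⊕ X).
  by move=> w; apply/idPn => nw; apply: no; exists X.
split=> // w; apply/idPn => nw; apply: no.
(* When [X] separates the games only with Left moving second, offer Left the move to [X]. Against
   [G], a Left move to [l] loses to the reply [adj l]; [adj 0] keeps the Right options nonempty. *)
exists (Game [:: X] (adj 0 :: map adj (lopts G))); split.
- apply: Udic => // g; rewrite inE; first by move/eqP->.
  by case/orP=> [/eqP ->|/mapP [? _ ->]].
- apply: Nlw1P; first by rewrite left_end_add andbF.
  move=> x /lopts_addP [] [y y_in ->]; last by move: y_in; rewrite inE => /eqP ->.
  apply: (Nlw2_opt (in_ropts_addr _ (h := adj y) _)); last exact: Nlw1_adj.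
  by rewrite inE map_f ?orbT.
- by apply: (lw1_opt (in_lopts_addr _ (h := X) _)); rewrite ?mem_head.
Qed.

Lemma nge_lw2 G H : ~ ge G H -> exists X, [/\ U X, ~~ lw2 (G ⊕ X) & lw2 (H ⊕ X)].
Proof.
move=> nge; have [|X [UX nw w]] := @nge_lw1 (conj H) (conj G).
  by move/ge_conj; rewrite !conjK.
exists (conj X); split; first exact: UC.
  by rewrite -lw1_conj conj_add conjK.
by move: nw; rewrite -[X]conjK -conj_add lw1_conj negbK conjK.
Qed.

(* The right option of [T] answering a Left move to [q'] separates [q'] from
   [z]; the left option answering a Right move to [z'] separates [q] from [z']. *)
Lemma downlink q z :
  (forall l, l \in lopts q -> ~ ge l z) -> (forall r, r \in ropts z -> ~ ge q r) ->
  exists T, [/\ U T, ~~ lw1 (q ⊕ T) & lw2 (z ⊕ T)].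
Proof.
move=> nl nr.
have [|RT [RT1 RT2]] :=
  @seq_choice (fun l X => [/\ U X, ~~ lw1 (l ⊕ X) & lw1 (z ⊕ X)]) (lopts q).
  by move=> l /nl /nge_lw1.
have [|LT [LT1 LT2]] :=
  @seq_choice (fun r X => [/\ U X, ~~ lw2 (q ⊕ X) & lw2 (r ⊕ X)]) (ropts z).
  by move=> r /nr /nge_lw2.
(* These keep the options of [T] nonempty: a Left move to [a] is refuted by [adj q], a Right move to
   [b] by [adj z]. *)
pose a := Game [:: 0] [:: adj q]; pose b := Game [:: adj z] [:: 0].
have Ua : U a by apply: Udic => // g; rewrite inE => /eqP ->.
have Ub : U b by apply: Udic => // g; rewrite inE => /eqP ->.
have wa : ~~ lw2 (q ⊕ a).
  by apply: Nlw2_opt (Nlw1_adj q); apply: in_ropts_addr; rewrite mem_head.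
have wb : lw1 (z ⊕ b).
  by apply: lw1_opt (lw2_adj z); apply: in_lopts_addr; rewrite mem_head.
exists (Game (a :: LT) (b :: RT)); split.
- apply: Udic => // g; rewrite inE => /orP [/eqP -> //|].
    by case/LT2=> ? _ [].
  by case/RT2=> ? _ [].
- apply: Nlw1P; first by rewrite left_end_add andbF.
  move=> x /lopts_addP [] [y y_in ->].
    have [X X_in [_ nw _]] := RT1 y y_in.
    by apply: Nlw2_opt nw; apply: in_ropts_addr; rewrite inE X_in orbT.
  by move: y_in; rewrite inE => /orP [/eqP -> //|/LT2 [? _ []]].
- apply/lw2P; split; first by rewrite right_end_add andbF.
  move=> x /ropts_addP [] [y y_in ->].
    have [X X_in [_ _ w]] := LT1 y y_in.
    by apply: lw1_opt w; apply: in_lopts_addr; rewrite inE X_in orbT.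
  by move: y_in; rewrite inE => /orP [/eqP -> //|/RT2 [? _ []]].
Qed.

(** Otherwise [downlink] gives [T] such that Left wins [z ⊕ T], hence [w ⊕ T], moving second,
    although she loses [q ⊕ T], hence [x ⊕ T], moving first. *)
Lemma ge_ropt w z x q : ge w z -> x \in ropts w -> ge q x ->
  (exists2 r, r \in ropts z & ge q r) \/ (exists2 l, l \in lopts q & ge l z).
Proof.
move=> wz x_in qx; apply: NNPP => no.
have [||T [UT nw wT]] := @downlink q z.
- by move=> l l_in lz; apply: no; right; exists l.
- by move=> r r_in qr; apply: no; left; exists r.
by case/negP: nw; apply: (ge_lw1 qx UT);
  apply: (lw2_opt (ge_lw2 wz UT wT)); apply: in_ropts_addl.
Qed.

Lemma ge_lopt w z x : ge z w -> x \in lopts w ->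
  (exists2 l, l \in lopts z & ge l x) \/ (exists2 r, r \in ropts x & ge z r).
Proof.
move=> zw x_in; apply: NNPP => no.
have [||T [UT nw wT]] := @downlink z x.
- by move=> l l_in lx; apply: no; left; exists l.
- by move=> r r_in zr; apply: no; right; exists r.
by case/negP: nw; apply: (ge_lw1 zw UT);
  apply: lw1_opt wT; apply: in_lopts_addl.
Qed.

Lemma ge0_lopt w x : ge 0 w -> x \in lopts w -> exists2 r, r \in ropts x & ge 0 r.
Proof. by move=> zw x_in; case: (ge_lopt zw x_in) => // -[]. Qed.

(** * Bypassing reversible options, and the pairing in a sum equivalent to 0 *)

Definition reversible G y := exists2 r, r \in ropts y & ge G r.

(* The forms reached from [G] by repeatedly passing from a position to the Right
   response that reverses one of its Left options; their Left options play the
   role of Left options of the form obtained from [G] by bypassing reversible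
   options, without ever leaving the subpositions of [G]. *)
Inductive chain (G : game) : game -> Prop :=
| ChainBase : chain G G
| ChainStep z y r : chain G z -> y \in lopts z -> r \in ropts y -> ge G r -> chain G r.

(** These are the Left options that survive the bypassing. *)
Definition essential G y :=
  (exists2 z, chain G z & y \in lopts z) /\ ~ reversible G y.

Lemma chain_ge G z : chain G z -> ge G z.
Proof. by case. Qed.

Lemma chain_U G z : U G -> chain G z -> U z.
Proof. by move=> UG; elim=> // {}z y r _ Uz /(Ul Uz) Uy /(Ur Uy). Qed.

Lemma chain_size G z : chain G z -> (gsize z <= gsize G)%N.
Proof. by elim=> // {}z y r _ IH /gsize_lopt ? /gsize_ropt; lia. Qed.

Lemma essential_U G y : U G -> essential G y -> U y.
Proof. by move=> UG [[z /(chain_U UG) Uz /(Ul Uz)]]. Qed.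

Lemma essential_size G y : essential G y -> (gsize y < gsize G)%N.
Proof. by case=> -[z /chain_size ? /gsize_lopt]; lia. Qed.

(** Adding [G] to [0 >= y ⊕ H] gives [G >= y ⊕ (G ⊕ H) >= y]. *)
Lemma cancel_ge G H y : U G -> U H -> U y -> ge (G ⊕ H) 0 -> ge 0 (y ⊕ H) -> ge G y.
Proof.
move=> UG UH Uy GH yH.
rewrite -[G]add0g; apply: ge_trans (ge_addr UG yH) _.
apply: ge_trans (geAC _ _ _) _; rewrite -addgA -[X in ge _ X]addg0.
exact: ge_addl.
Qed.

(** Right's good reply to the Left move to [y ⊕ H] is not in [y], since by [cancel_ge] it would
    reverse [y]; so it is in [H]. If that reply is itself reversible, Left plays the reversing
    response and Right must again answer outside [y]; sizes decrease until the reply is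
    nonreversible. *)
Lemma essential_pair G H y : U G -> U H -> ge (G ⊕ H) 0 -> ge 0 (G ⊕ H) ->
  essential G y -> exists2 h, essential (conj H) h & ge 0 (y ⊕ conj h).
Proof.
move=> UG UH GH0 GH0' [[z cz y_in] nrev].
have Uy : U y := Ul (chain_U UG cz) y_in.
have nrevH y' : y' \in ropts y -> ~ ge 0 (y' ⊕ H).
  move=> y'_in le0; apply: nrev; exists y' => //.
  exact: cancel_ge (Ur Uy y'_in) GH0 le0.
have zH : ge 0 (z ⊕ H) by apply: ge_trans GH0' _; apply/ge_addr/chain_ge.
have [r] := ge0_lopt zH (in_lopts_addl H y_in).
case/ropts_addP=> -[x x_in ->]; first by move/(nrevH _ x_in).
have {x_in} : exists2 w, chain (conj H) w & conj x \in lopts w.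
  by exists (conj H); [exact: ChainBase|exact: conj_ropt].
rewrite -{2}[x]conjK; move: (conj x) => {}x; have [n] := ubnP (gsize x).
elim: n x => // n IH x lt_n [w cw x_in] le0.
case: (classic (reversible (conj H) x)) => [[s s_in Hs]|]; last first.
  by move=> nrevx; exists x => //; split=> //; exists w.
have s_in' : conj s \in lopts (conj x) by exact: conj_ropt.
have [t] := ge0_lopt le0 (in_lopts_addr y s_in').
case/ropts_addP=> -[v v_in ->] le0'.
  case: (nrevH v v_in); apply: ge_trans le0' _; apply: ge_addl (Ur Uy v_in) _.
  by rewrite -[H]conjK; apply: ge_conj.
have v_in' : conj v \in lopts s by rewrite -[s]conjK; apply: conj_ropt.
apply: (IH (conj v)).
- by have := gsize_lopt v_in'; have := gsize_ropt s_in; lia.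
- by exists s => //; apply: ChainStep cw x_in s_in Hs.
- by rewrite conjK.
Qed.

(** * Subpositions, and a cycle in the pairing *)

Fixpoint followers (G : game) : seq game :=
  let: Game L R := G in
  G :: flatten (map followers L) ++ flatten (map followers R).

Lemma followers_self G : G \in followers G.
Proof. by case: G => L R; rewrite mem_head. Qed.

Lemma followers_opts G g x : g \in followers G -> x \in lopts g ++ ropts g ->
  x \in followers G.
Proof.
elim/game_ind_opts: G => -[L R] /= IHl IHr.
rewrite inE mem_cat => /or3P [/eqP -> /=||] //.
- rewrite inE !mem_cat => /orP [] x_in; apply/orP; right; apply/orP;
    [left|right]; apply/flatten_mapP; exists x => //; exact: followers_self.
- case/flatten_mapP=> y y_in g_in x_in; rewrite inE mem_cat.
  apply/or3P/Or32/flatten_mapP; exists y => //; exact: IHl.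
- case/flatten_mapP=> y y_in g_in x_in; rewrite inE mem_cat.
  apply/or3P/Or33/flatten_mapP; exists y => //; exact: IHr.
Qed.

Lemma chain_followers G z : chain G z -> z \in followers G.
Proof.
elim=> [|{}z y r _ IH y_in r_in _]; first exact: followers_self.
have y_in' : y \in followers G by apply: followers_opts IH _; rewrite mem_cat y_in.
by apply: followers_opts y_in' _; rewrite mem_cat r_in orbT.
Qed.

Lemma essential_followers G y : essential G y -> y \in followers G.
Proof.
case=> -[z /chain_followers z_in y_in] _.
by apply: followers_opts z_in _; rewrite mem_cat y_in.
Qed.

(** Successors are chosen on a finite list only, so excluded middle suffices to build [f]. *)
Lemma succ_fun (F : seq game) (P : game -> Prop) (R : game -> game -> Prop) :
  (forall y, y \in F -> P y -> exists2 x, P x & R y x) ->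
  exists f, forall y, y \in F -> P y -> P (f y) /\ R y (f y).
Proof.
elim: F => [|a F IH] ex; first by exists id.
have [|f f_ok] := IH; first by move=> y y_in; apply: ex; rewrite inE y_in orbT.
case: (classic (P a)) => [/(ex a (mem_head _ _)) [b Pb Rb]|nPa].
  exists (fun y => if y == a then b else f y) => y; rewrite inE.
  by case: eqP => [-> _ _|_] //=; apply: f_ok.
exists f => y; rewrite inE => /orP [/eqP ->|] //; exact: f_ok.
Qed.

(** Pigeonhole: the first [(size F).+1] iterates lie in [F], so two of them coincide. *)
Lemma iter_periodic (F : seq game) (P : game -> Prop) (f : game -> game) y :
  (forall x, P x -> x \in F) -> (forall x, P x -> P (f x)) -> P y ->
  exists i n, iter n.+1 f (iter i f y) = iter i f y.
Proof.
move=> PF Pf Py.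
have Pit i : P (iter i f y) by elim: i => //= i; apply: Pf.
have : ~~ uniq (traject f y (size F).+1).
  apply/negP => /uniq_leq_size sub; have := sub F.
  rewrite size_traject ltnn => {}sub; suff: false by [].
  by apply: sub => x /trajectP [i _ ->]; apply: PF.
rewrite looping_uniq negbK => /trajectP [i lt_i eq_i].
by exists i, (size F - i.+1)%N; rewrite -iterD -[RHS]eq_i; congr (iter _ f y); lia.
Qed.

Lemma ge0_conj G H : ge 0 (G ⊕ H) -> ge (conj G ⊕ conj H) 0.
Proof. by move/ge_conj; rewrite conj_add. Qed.

Lemma conj_ge0 G H : ge (G ⊕ H) 0 -> ge 0 (conj G ⊕ conj H).
Proof. by move/ge_conj; rewrite conj_add. Qed.

(* Following the pairing of essential options back and forth one gets essential
   options with [y i + conj (h i) <= 0 <= y (i+1) + conj (h i)]; by finiteness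
   some [y i] recurs, and there [y i + conj (h i)] is equivalent to zero. *)
Lemma essential_le0 G H : U G -> U H -> ge (G ⊕ H) 0 -> ge 0 (G ⊕ H) ->
  (forall y h, essential G y -> essential (conj H) h ->
     ge 0 (y ⊕ conj h) -> ge (y ⊕ conj h) 0 -> ge 0 y /\ ge y 0) ->
  forall y, essential G y ->
    ge 0 y /\ exists2 y0, essential G y0 & ge 0 y0 /\ ge y0 0.
Proof.
move=> UG UH GH0 GH0' IH y ess_y.
pose R y y' := exists h,
  [/\ essential (conj H) h, ge 0 (y ⊕ conj h) & ge (y' ⊕ conj h) 0].
have UcH h : essential (conj H) h -> U (conj h).
  by move=> ess_h; apply: UC; apply: essential_U ess_h; apply: UC.
have Uess := essential_U UG.
have [|f f_ok] := @succ_fun (followers G) (essential G) R.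
  move=> x _ ess_x.
  have [h ess_h le0] := essential_pair UG UH GH0 GH0' ess_x.
  have [||x' ess_x' le0'] := essential_pair (UC UH) (UC UG) _ _ ess_h.
  - exact: ge_trans (geC _ _) (ge0_conj GH0').
  - exact: ge_trans (conj_ge0 GH0) (geC _ _).
  rewrite conjK in ess_x'; exists x' => //; exists h; split=> //.
  apply: ge_trans (geC _ _) _.
  by have := ge0_conj le0'; rewrite conjK.
have {}f_ok x : essential G x -> essential G (f x) /\ R x (f x).
  by move=> ess_x; apply: f_ok => //; apply: essential_followers.
have ess_it i x : essential G x -> essential G (iter i f x).
  by move=> ess_x; elim: i => //= i /f_ok [].
have [i [n per]] := iter_periodic (@essential_followers G) (fun x e => (f_ok x e).1) ess_y.
set z := iter i f y in per; have ess_z : essential G z by apply: ess_it.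
have [_ [h [ess_h zh0 fzh0]]] := f_ok z ess_z.
(* [M] adds to [conj h] the sums [w ⊕ conj h'] met on the way. Each is [<= 0], so [M <= conj h];
   regrouped, [M] and the last iterate form sums that are all [>= 0]. One full period then returns
   to [z]. *)
have sums k : exists M, [/\ U M, ge (conj h) M & ge (iter k.+1 f z ⊕ M) 0].
  elim: k => [|k [M [UM hM wM]]]; first by exists (conj h); split=> //; apply: UcH.
  set w := iter k.+1 f z in wM; have ess_w : essential G w by apply: ess_it.
  have [ess_fw [h' [ess_h' wh0 fwh0]]] := f_ok w ess_w.
  have Uh' := UcH h' ess_h'; have Uw := Uess w ess_w; have Ufw := Uess _ ess_fw.
  exists (M ⊕ (w ⊕ conj h')); split; first by do 2!apply: UD => //.
    apply: ge_trans hM _; rewrite -[X in ge X _]addg0; exact: ge_addl.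
  rewrite iterS -/w; apply: ge_trans (ge_add_ge0 (UD Ufw Uh') fwh0 wM).
  rewrite addgA !addgA; apply: ge_trans (geAC _ _ _) _.
  rewrite -!addgA; apply: ge_addl => //.
  apply: ge_trans (geC _ _) _; rewrite -addgA; apply: ge_addl => //; exact: geC.
have [M [UM hM]] := sums n; rewrite per => zM0.
have zh0' : ge (z ⊕ conj h) 0.
  by apply: ge_trans zM0; apply: ge_addl; first exact: Uess.
have [z_le0 z_ge0] := IH z h ess_z ess_h zh0 zh0'.
split; last by exists z.
(* The bound travels back from [z] to [y]: if [f y <= 0] then [conj h >= f y ⊕ conj h >= 0], hence
   [0 >= y ⊕ conj h >= y]. *)
have {sums per ess_z zh0 fzh0 zM0 zh0' z_ge0 h ess_h hM} : ge 0 z by [].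
rewrite /z; elim: i y ess_y {z z_le0} => // i IHi y ess_y.
have [ess_fy [h [ess_h yh0 fyh0]]] := f_ok y ess_y.
rewrite iterSr => /(IHi _ ess_fy) fy_le0.
apply: ge_trans yh0 _; rewrite -[X in ge _ X]addg0; apply: ge_addl.
  exact: Uess.
apply: ge_trans fyh0; rewrite -[X in ge X _]add0g; apply: ge_addr => //.
exact: UcH.
Qed.

(** * Bounds on a game from its essential options *)

Definition ess_zero G := exists2 y, essential G y & ge 0 y /\ ge y 0.

Lemma essential_or_reversible G z y : chain G z -> y \in lopts z ->
  essential G y \/ reversible G y.
Proof.
move=> cz y_in; case: (classic (reversible G y)) => [|nrev]; [by right|left].
by split=> //; exists z.
Qed.

(** Every Left option met is reversible, so bypassing continues until no Left option remains. *)
Lemma chain_left_end G : (forall y, ~ essential G y) ->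
  exists2 K, chain G K & left_end K.
Proof.
move=> noess; suff: forall n z, (gsize z < n)%N -> chain G z ->
  exists2 K, chain G K & left_end K by move=> /(_ _ G (ltnSn _)); apply; apply: ChainBase.
elim=> // n IH z lt_n cz; case: (boolP (left_end z)) => [|nend]; first by exists z.
have [y y_in] : exists y, y \in lopts z.
  by case: z nend {lt_n cz} => [[|a L] R] // _; exists a; rewrite mem_head.
case: (essential_or_reversible cz y_in) => [/noess //|[r r_in Gr]].
apply: (IH r); last exact: ChainStep cz y_in r_in Gr.
by have := gsize_lopt y_in; have := gsize_ropt r_in; lia.
Qed.

Lemma Lstrong_noess G : (forall y, ~ essential G y) -> Lstrong G.
Proof.
by move=> /chain_left_end [K /chain_ge GK endK]; apply: Lstrong_ge GK (Lstrong_end endK).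
Qed.

Lemma essential_nend G y : essential G y -> ~~ left_end G.
Proof.
case=> -[z cz y_in] _; apply/negP => endG.
suff E : z = G by move: y_in; rewrite E; apply: left_endP.
by elim: {y_in} cz => // z' x r _ -> /(left_endP endG).
Qed.

(** Proved for all chain positions at once: a reversible option leads to a smaller chain position,
    so only essential options need a match in [M]. Right options of [M] may be matched in any [w]
    above [G], by [ge_ropt]. *)
Lemma chain_le G M :
  (forall y, essential G y -> exists2 m, m \in lopts M & ge m y) ->
  (forall x, x \in ropts M ->
     exists w, exists2 x', ge w G & x' \in ropts w /\ ge x x') ->
  (Lstrong G -> Lstrong M) -> (right_end M -> Lstrong (conj G)) -> ge M G.
Proof.
move=> ML MR sM sG; suff: forall n z, (gsize z < n)%N -> chain G z -> ge M z.
  by move=> /(_ _ G (ltnSn _)); apply; apply: ChainBase.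
elim=> // n IH z lt_n cz; have Gz := chain_ge cz; apply: ge_suff.
- move=> x /MR [w [x' wG [x'_in xx']]].
  exact: ge_ropt (ge_trans wG Gz) x'_in xx'.
- move=> y y_in; case: (essential_or_reversible cz y_in) => [/ML|[r r_in Gr]].
    by left.
  right; exists r => //; apply: IH; last exact: ChainStep cz y_in r_in Gr.
  by have := gsize_lopt y_in; have := gsize_ropt r_in; lia.
- by move=> /Lstrong_end/(Lstrong_ge Gz)/sM.
- by move/sG; apply: Lstrong_ge; apply: ge_conj.
Qed.

Lemma zero_right G : ess_zero (conj G) ->
  exists w, exists2 x, ge w G & x \in ropts w /\ ge 0 x.
Proof.
case=> y [[z /chain_ge Gz y_in] _] [_ /ge_conj y0]; exists (conj z), (conj y).
  by rewrite -[G]conjK; apply: ge_conj.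
by split; first exact: conj_lopt.
Qed.

Lemma zero_ropt G K : ess_zero (conj G) -> ge G K ->
  exists2 k, k \in ropts K & ge 0 k.
Proof.
move=> /zero_right [w [x wG [x_in x0]]] GK.
by case: (ge_ropt (ge_trans wG GK) x_in x0) => [//|[]].
Qed.

(** * Right's wins when a killer accompanies a game like -1 or star *)

Lemma Nlw1_oL G : oL G = Right -> ~~ lw1 G.
Proof. by rewrite /lw1 => ->. Qed.

Lemma Nlw2_oR G : oR G = Right -> ~~ lw2 G.
Proof. by rewrite /lw2 => ->. Qed.

Lemma super_starkillerW G : super_starkiller G -> disintegrator G /\ starkiller G.
Proof.
have [n] := ubnP (gsize G); elim: n G => // n IH G lt_n [r r_in nend wr wl].
have sub l : l \in lopts r -> super_starkiller l -> disintegrator l /\ starkiller l.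
  move=> l_in; apply: IH.
  by have := gsize_lopt l_in; have := gsize_ropt r_in; lia.
split; [apply: Disintegrator r_in _ _ | apply: Starkiller r_in _ _] => // l l_in;
  by case: (wl l l_in) => [|/(sub l l_in) []]; auto.
Qed.

Definition neg1 := Game [::] [:: 0].
Definition star := Game [:: 0] [:: 0].

Lemma U_star : U star.
Proof. by apply: Udic => // g; rewrite inE => /eqP ->. Qed.
Hint Resolve U_star : core.

(** Right keeps moving to the witness [r], where Left has moves, but none in [K]. Once Left reaches
    an option that she loses moving first, Right moves [K] to [k <= 0]. *)
Lemma Nlw2_disintegrator K k Z : left_end K -> k \in ropts K -> ge 0 k -> U Z ->
  disintegrator Z \/ ~~ lw1 Z -> ~~ lw2 (K ⊕ Z).
Proof.
move=> endK k_in k0; have [n] := ubnP (gsize Z); elim: n Z => // n IH Z lt_n UZ.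
case=> [[r r_in nend wr]|nw]; last first.
  apply: (Nlw2_opt (in_ropts_addl Z k_in)); apply: contra nw => w.
  by rewrite -[Z]add0g; apply: ge_lw1 w.
apply: (Nlw2_opt (in_ropts_addr K r_in)); apply: Nlw1P.
  by rewrite left_end_add negb_and nend orbT.
move=> x /lopts_addP [] [l l_in ->]; first by case: (left_endP endK l_in).
apply: IH; first by have := gsize_lopt l_in; have := gsize_ropt r_in; lia.
  exact: Ul (Ur UZ r_in) l_in.
by case: (wr l l_in) => [/Nlw1_oL|]; auto.
Qed.

(** As with disintegrators, but Left may also move [star] to 0; that loses because Right, moving
    first, wins the witness. *)
Lemma Nlw2_starkiller Z : starkiller Z \/ ~~ lw1 Z -> ~~ lw2 (star ⊕ Z).
Proof.
have [n] := ubnP (gsize Z); elim: n Z => // n IH Z lt_n.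
case=> [[r r_in wr wl]|nw]; last first.
  by apply: (Nlw2_opt (in_ropts_addl (G := star) Z (mem_head _ _))); rewrite add0g.
apply: (Nlw2_opt (in_ropts_addr star r_in)); apply: Nlw1P.
  by rewrite left_end_add.
move=> x /lopts_addP [] [l l_in ->].
  by move: l_in; rewrite inE => /eqP ->; rewrite add0g; apply: Nlw2_oR.
apply: IH; first by have := gsize_lopt l_in; have := gsize_ropt r_in; lia.
by case: (wl l l_in) => [/Nlw1_oL|]; auto.
Qed.

(** * Forms whose tombstones are replaced by end-reversible options *)

Definition zform (EL ER : seq game) := Game (0 :: EL) (0 :: map conj ER).

(** For this symmetry [zform] stores the Right replacements conjugated. *)
Lemma conj_zform EL ER : conj (zform EL ER) = zform ER EL.
Proof. by rewrite /zform /= -map_comp (eq_map conjK) map_id. Qed.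

Lemma U_zform EL ER : (forall E, E \in EL -> U E) -> (forall E, E \in ER -> U E) ->
  U (zform EL ER).
Proof.
move=> UL UR; apply: Udic => // g; rewrite inE => /orP [/eqP -> //|]; first exact: UL.
by case/mapP=> E /UR ? ->; apply: UC.
Qed.

Lemma zform_ge EL ER K : Lstrong (zform EL ER) -> left_end K ->
  (exists2 k, k \in ropts K & ge 0 k) ->
  (forall E, E \in ER -> exists2 KE, KE \in ropts E & ge (conj KE) K) ->
  ge (zform EL ER) K.
Proof.
move=> sD endK [k k_in k0] revR; apply: ge_suff => // [r|l /(left_endP endK) []].
rewrite inE => /orP [/eqP ->|/mapP [E /revR [KE KE_in geK] ->]].
  by left; exists k.
by right; exists (conj KE) => //; apply: conj_ropt.
Qed.

Definition end_rev G E := exists K, [/\ K \in ropts E, left_end K & ge G K].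

Lemma end_revE G E : left_end_reversible U G E <-> end_rev G E.
Proof.
by split=> -[K [K_in endK /game_geE geK]]; exists K; split=> //; apply/game_geE.
Qed.

Lemma expansion0 : expansion U (aform_of 0) 0.
Proof. exact: (@Expansion U false false [::] [::] [::] [::] [::] [::]). Qed.

Lemma expansion_zeros : List.Forall2 (expansion U) [:: aform_of 0] [:: 0].
Proof. by constructor; [exact: expansion0|constructor]. Qed.

Lemma hat_zform_l EL : EL != [::] -> (forall E, E \in EL -> U E) ->
  (forall E, E \in EL -> end_rev (zform EL [::]) E) ->
  hat U (AForm true [:: aform_of 0] [:: aform_of 0] false).
Proof.
move=> nEL UEL rev; exists (zform EL [::]); split; first exact: U_zform.
apply: (@Expansion U true false [:: aform_of 0] [:: aform_of 0] [:: 0] [:: 0] EL [::]);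
  rewrite ?nEL //; try exact: expansion_zeros.
by move=> E /rev /end_revE.
Qed.

Lemma hat_zform EL ER : EL != [::] -> ER != [::] ->
  (forall E, E \in EL -> U E) -> (forall E, E \in ER -> U E) ->
  (forall E, E \in EL -> end_rev (zform EL ER) E) ->
  (forall E, E \in ER -> end_rev (zform ER EL) E) ->
  hat U (AForm true [:: aform_of 0] [:: aform_of 0] true).
Proof.
move=> nEL nER UEL UER revL revR; exists (zform EL ER); split; first exact: U_zform.
apply: (@Expansion U true true [:: aform_of 0] [:: aform_of 0] [:: 0] [:: 0]
          EL (map conj ER)); rewrite ?nEL //; try exact: expansion_zeros.
- by case: (ER) nER.
- by move=> E /revL /end_revE.
move=> F /mapP [E /revR [K [K_in endK geK]] ->]; exists (conj K); split.
- exact: conj_ropt.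
- by rewrite right_end_conj.
by apply/game_geE; have := ge_conj geK; rewrite conj_zform.
Qed.

(** Left's winning move is in [z]. An essential option is [<= 0] and leaves her winning [Y] moving
    second; a reversible one either reverses through a Left end or passes to a smaller chain
    position still won by Left. *)
Lemma end_rev_win G z Y : U G -> (forall y, essential G y -> ge 0 y) ->
  U Y -> left_end Y -> chain G z -> ~~ left_end z -> lw1 (z ⊕ Y) ->
  lw2 Y \/ exists2 E, E \in followers G /\ U E & end_rev G E /\ lw2 (E ⊕ Y).
Proof.
move=> UG ess0 UY endY; have [n] := ubnP (gsize z); elim: n z => // n IH z lt_n cz nend.
case/lw1P; first by rewrite left_end_add (negPf nend).
case=> x /lopts_addP [] [y y_in ->]; last by case: (left_endP endY y_in).
have Uz := chain_U UG cz; have Uy := Ul Uz y_in => w.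
case: (essential_or_reversible cz y_in) => [/ess0 le0|[r r_in Gr]].
  by left; rewrite -[Y]add0g; apply: ge_lw2 w.
case: (boolP (left_end r)) => [endr|nendr].
  right; exists y; split=> //; last by exists r.
  by apply: followers_opts (chain_followers cz) _; rewrite mem_cat y_in.
apply: (IH r) => //; first by have := gsize_lopt y_in; have := gsize_ropt r_in; lia.
  exact: ChainStep cz y_in r_in Gr.
by apply: (lw2_opt w); apply: in_ropts_addl.
Qed.

Lemma end_rev_seq G : U G -> (forall y, essential G y -> ge 0 y) -> ~~ left_end G ->
  Lstrong G ->
  exists EL : seq game,
    [/\ EL != [::], forall E, E \in EL -> U E /\ end_rev G E &
        forall Y, U Y -> left_end Y -> lw2 Y \/ exists2 E, E \in EL & lw2 (E ⊕ Y)].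
Proof.
move=> UG ess0 nend sG.
have [EL EL_ok] := seq_filter (fun E => U E /\ end_rev G E) (followers G).
have win Y : U Y -> left_end Y -> lw2 Y \/ exists2 E, E \in EL & lw2 (E ⊕ Y).
  move=> UY endY.
  have [|[E [E_in UE] [revE w]]] :=
    end_rev_win UG ess0 UY endY (ChainBase G) nend (sG Y UY endY); first by left.
  by right; exists E => //; apply/EL_ok.
exists EL; split=> //; last by move=> E /EL_ok [].
(* At [Y = 0] the first alternative fails, as Right cannot move and wins; so [EL] is nonempty. *)
case: (win 0 U0 isT) => [|[E E_in _]]; first by rewrite (negPf (lw2_right_end _)).
by case: (EL) E_in.
Qed.

Lemma Lstrong_zform EL ER :
  (forall Y, U Y -> left_end Y -> lw2 Y \/ exists2 E, E \in EL & lw2 (E ⊕ Y)) ->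
  Lstrong (zform EL ER).
Proof.
move=> win Y UY endY; case: (win Y UY endY) => [w|[E E_in w]].
  by apply: (lw1_opt (in_lopts_addl (G := zform EL ER) _ (mem_head _ _))); rewrite add0g.
by apply: (lw1_opt (in_lopts_addl _ (g := E) _)) => //; rewrite inE E_in orbT.
Qed.

(** * Refuting the shapes like 1, -1 and star *)

Definition hat3 := hat U (AForm true [:: aform_of 0] [:: aform_of 0] false).
Definition hat5 := hat U (AForm true [:: aform_of 0] [:: aform_of 0] true).

Lemma ge_one_weak G : (forall y, essential G y -> ge 0 y) ->
  (forall y, ~ essential (conj G) y) -> ~ Lstrong G -> ge game1 G.
Proof.
move=> ess0 noess nsG; apply: chain_le => //.
- by move=> y /ess0 le0; exists 0; rewrite ?mem_head.
- by move=> _; apply: Lstrong_noess.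
Qed.

Lemma ge_neg1 G : (forall y, ~ essential G y) -> ess_zero (conj G) -> ge neg1 G.
Proof.
move=> noess ess0; apply: chain_le => // [y /noess //|x|_].
  by rewrite inE => /eqP ->; apply: zero_right.
exact: Lstrong_end.
Qed.

Lemma ge_star G : (forall y, essential G y -> ge 0 y) -> ess_zero (conj G) ->
  ~ Lstrong G -> ge star G.
Proof.
move=> ess0 zero nsG; apply: chain_le => // [y /ess0 le0|x].
  by exists 0; rewrite ?mem_head.
by rewrite inE => /eqP ->; apply: zero_right.
Qed.

(** Moving 1 to 0 leaves [z ⊕ X], and [H >= z]. Any other winning move is reversible, and after the
    reversing response the same argument applies to a smaller chain position. *)
Lemma one_add_lw2 H z X : (forall y, ~ essential H y) -> chain H z ->
  U X -> left_end X -> lw1 (game1 ⊕ (z ⊕ X)) -> lw2 (H ⊕ X).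
Proof.
move=> noess cz UX endX; have [n] := ubnP (gsize z); elim: n z cz => // n IH z cz lt_n.
case/lw1P; first by rewrite left_end_add.
case=> x /lopts_addP [] [y y_in ->].
  move: y_in; rewrite inE => /eqP ->; rewrite add0g.
  exact: ge_lw2 (chain_ge cz) UX.
case/lopts_addP: y_in => -[{}y y_in ->]; last by case: (left_endP endX y_in).
case: (essential_or_reversible cz y_in) => [/noess //|[r r_in Hr]] w.
apply: (IH r); first exact: ChainStep cz y_in r_in Hr.
  by have := gsize_lopt y_in; have := gsize_ropt r_in; lia.
by apply: (lw2_opt w); apply: in_ropts_addr; apply: in_ropts_addl.
Qed.

Lemma sum_ge0_lw1 G H X : ge (G ⊕ H) 0 -> U X -> left_end X -> lw1 (G ⊕ (H ⊕ X)).
Proof.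
move=> GH0 UX endX; rewrite addgA; apply: ge_lw1 GH0 UX _.
by rewrite add0g; apply: lw1_end.
Qed.

(* [G] behaves like 1 and [H] like -1. The Left end [K] need not be equivalent to
   [H], but [neg1 + K + Z] is a Left end whenever [Z] is, so the response [H + K]
   in [E] covers the positions where the nondisintegrator strategy stops. *)
Lemma weak_one_absurd G H : U G -> U H -> ge (G ⊕ H) 0 ->
  (forall y, essential G y -> ge 0 y) -> (forall y, ~ essential (conj G) y) ->
  (forall y, ~ essential H y) -> ess_zero (conj H) -> ~ Lstrong G ->
  (hat3 -> exists S, [/\ U S, left_end S & super_starkiller S]) -> False.
Proof.
move=> UG UH GH0 essG noG noH zeroH nsG cond3.
have G1 := ge_one_weak essG noG nsG; have H1 := ge_neg1 noH zeroH.
have winH X : U X -> left_end X -> lw2 (H ⊕ X).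
  move=> UX endX; apply: (one_add_lw2 noH (ChainBase H) UX endX).
  by apply: (ge_lw1 G1 (UD UH UX)); apply: sum_ge0_lw1.
have win1 X : U X -> left_end X -> lw2 (neg1 ⊕ X).
  by move=> UX endX; apply: (ge_lw2 H1 UX); apply: winH.
have [K cK endK] := chain_left_end noH.
have UK := chain_U UH cK; have [k k_in k0] := zero_ropt zeroH (chain_ge cK).
pose E := Game [:: H ⊕ K] [:: K].
have UE : U E by apply: Udic => // g; rewrite inE => /eqP ->; auto.
(* Left follows her strategy for [neg1 ⊕ (K ⊕ Z)]: Right's move of [E] to [K] imitates that of
   [neg1] to 0. When Right leaves a Left end beside [E], she moves to [H ⊕ K] and wins by [winH]. *)
have winE Z : U Z -> lw2 (neg1 ⊕ (K ⊕ Z)) -> lw2 (E ⊕ Z).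
  have [n] := ubnP (gsize Z); elim: n Z => // n IH Z lt_n UZ w; apply/lw2P; split.
    by rewrite right_end_add.
  move=> x /ropts_addP [] [r r_in ->].
    move: r_in; rewrite inE => /eqP ->; rewrite -[K ⊕ Z]add0g.
    by apply: (lw2_opt w); apply: in_ropts_addl; rewrite mem_head.
  have Ur' := Ur UZ r_in.
  have: lw1 (neg1 ⊕ (K ⊕ r)).
    by apply: (lw2_opt w); do 2!apply: in_ropts_addr.
  case/lw1P=> [|[y]].
    rewrite !left_end_add => /and3P [_ _ endr].
    apply: (lw1_opt (in_lopts_addl (G := E) _ (mem_head _ _))).
    by rewrite -addgA; apply: winH; [exact: UD|rewrite left_end_add endK].
  case/lopts_addP=> -[v v_in ->] //.
  case/lopts_addP: v_in => -[{}v v_in ->]; first by case: (left_endP endK v_in).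
  move=> wv; apply: (lw1_opt (in_lopts_addr E v_in)).
  apply: IH wv; last exact: Ul Ur' v_in.
  by have := gsize_lopt v_in; have := gsize_ropt r_in; lia.
have sD : Lstrong (zform [:: E] [::]).
  apply: Lstrong_zform => Y UY endY; right; exists E; rewrite ?mem_head //.
  by apply: winE => //; apply: win1; [exact: UD|rewrite left_end_add endK].
(* [{0, E | 0}] expands the form with a Left tombstone, because [E] reverses through [K]. The
   resulting super starkiller is a disintegrator, contradicting [win1]. *)
have [|S [US endS ssS]] := cond3.
  apply: (@hat_zform_l [:: E]) => // F; rewrite inE => /eqP -> //.
  exists K; split; rewrite ?mem_head //.
  by apply: zform_ge => //; exists k.
have /negP [] := @Nlw2_disintegrator neg1 0 S isT (mem_head _ _) (ge_refl 0) US
  (or_introl (super_starkillerW ssS).1).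
exact: win1.
Qed.

Lemma le0_left_end K : left_end K -> Lstrong (conj K) -> ge 0 K.
Proof.
move=> endK sK; apply: ge_suff => // [l /(left_endP endK) []|_].
exact: Lstrong_end.
Qed.

(* [G] behaves like [{tombstone, 0 | .}]. The options built here expand
   [{tombstone, 0 | 0, tombstone}]: Left's winning options in [G + (2K + Y)], for
   Left ends [Y], are turned into options with a Left end [<= K] as a Right
   response. *)
Lemma Lstrong_one_absurd G : U G -> (forall y, essential G y -> ge 0 y) ->
  ess_zero G -> (forall y, ~ essential (conj G) y) -> Lstrong G -> ~ hat5 -> False.
Proof.
move=> UG essG zeroG noG sG; apply.
have nendG : ~~ left_end G by case: zeroG => y /essential_nend.
have [EL [nEL EL_ok winEL]] := end_rev_seq UG essG nendG sG.
have [K cK endK] := chain_left_end noG; have GK := chain_ge cK.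
have UK : U K := chain_U (UC UG) cK.
have [k k_in k0] : exists2 k, k \in ropts K & ge 0 k.
  by apply: (@zero_ropt (conj G)) => //; rewrite conjK.
have Uk := Ur UK k_in.
have cKG : ge (conj K) G by rewrite -[G]conjK; apply: ge_conj.
have K0 : ge 0 K by apply: le0_left_end => //; apply: Lstrong_ge cKG sG.
pose K2 := K ⊕ K; have UK2 : U K2 by apply: UD.
have endK2 : left_end K2 by rewrite left_end_add endK.
have K20 : ge K K2 by rewrite -[X in ge X _]addg0; apply: ge_addl.
pose EK := [seq E ⊕ K2 | E <- EL].
pose E' := Game (K2 :: EK) [:: K].
have UEK E : E \in EK -> U E by case/mapP=> F /EL_ok [UF _] ->; apply: UD.
have UE' : U E'.
  apply: Udic => // g; rewrite inE; last by move/eqP->.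
  by case/orP=> [/eqP -> //|/UEK].
have winEK Y : U Y -> left_end Y -> lw2 (K2 ⊕ Y) \/ exists2 E, E \in EK & lw2 (E ⊕ Y).
  move=> UY endY; have endKY : left_end (K2 ⊕ Y) by rewrite left_end_add endK2.
  case: (winEL _ (UD UK2 UY) endKY) => [|[E E_in w]]; [by left|right].
  by exists (E ⊕ K2); [apply: (map_f (game_add^~ K2))|rewrite -addgA].
(* Left follows her strategy for [K2 ⊕ Z]. Right's move of [E'] to [K] imitates moving one of the
   two copies of [K] to [k <= 0]; when Right leaves a Left end, some option of [E'] wins. *)
have winE' Z : U Z -> lw2 (K2 ⊕ Z) -> lw2 (E' ⊕ Z).
  have [n] := ubnP (gsize Z); elim: n Z => // n IH Z lt_n UZ w; apply/lw2P; split.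
    by rewrite right_end_add.
  move=> x /ropts_addP [] [r r_in ->].
    move: r_in; rewrite inE => /eqP ->; rewrite -[K ⊕ Z]add0g.
    apply: (ge_lw1 k0 (UD UK UZ)); rewrite addgA; apply: (lw2_opt w).
    by apply: in_ropts_addl; apply: in_ropts_addl.
  have Ur' := Ur UZ r_in; have: lw1 (K2 ⊕ r) by apply: (lw2_opt w); apply: in_ropts_addr.
  case/lw1P=> [|[y /lopts_addP [] [v v_in ->] wv]].
  - rewrite left_end_add => /andP [_ endr].
    case: (winEK _ Ur' endr) => [w'|[E E_in w']].
      exact: (lw1_opt (in_lopts_addl (G := E') _ (mem_head _ _))).
    apply: (lw1_opt (in_lopts_addl (G := E') (g := E) _ _)) => //.
    by rewrite inE E_in orbT.
  - by case: (left_endP endK2 v_in).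
  apply: (lw1_opt (in_lopts_addr E' v_in)); apply: IH wv; last exact: Ul Ur' v_in.
  by have := gsize_lopt v_in; have := gsize_ropt r_in; lia.
pose D := zform (E' :: EK) (E' :: EK).
have sD : Lstrong D.
  apply: Lstrong_zform => Y UY endY; right.
  case: (winEK Y UY endY) => [w|[E E_in w]].
    by exists E'; rewrite ?mem_head //; apply: winE'.
  by exists E; rewrite // inE E_in orbT.
have ends E : E \in E' :: EK -> exists2 KE, KE \in ropts E & left_end KE /\ ge K KE.
  rewrite inE => /orP [/eqP ->|/mapP [F /EL_ok [UF [KF [KF_in endKF GKF]]] ->]].
    by exists K; rewrite ?mem_head.
  exists (KF ⊕ K2); first exact: in_ropts_addl.
  rewrite left_end_add endKF; split=> //; apply: ge_trans K20 _.
  rewrite -[X in ge X _]add0g; apply: ge_addr => //; apply: le0_left_end => //.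
  apply: Lstrong_ge (ge_conj (ge_trans cKG GKF)) _.
  by rewrite conjK; apply: Lstrong_end.
have DK : ge D K.
  apply: zform_ge => //; first by exists k.
  move=> E /ends [KE KE_in [_ geKE]]; exists KE => //.
  apply: (@ge_trans _ 0) => //; exact: (ge_conj (ge_trans K0 geKE)).
have UD' E : E \in E' :: EK -> U E by rewrite inE => /orP [/eqP -> //|/UEK].
have rev E : E \in E' :: EK -> end_rev D E.
  move=> /ends [KE KE_in [endKE geKE]]; exists KE; split=> //.
  exact: ge_trans DK geKE.
exact: (@hat_zform (E' :: EK) (E' :: EK)).
Qed.

Lemma zform_end_rev G EL ER : ess_zero (conj G) -> Lstrong (zform EL ER) ->
  (forall E, E \in EL -> end_rev G E) -> (forall E, E \in ER -> end_rev (conj G) E) ->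
  forall E, E \in EL -> end_rev (zform EL ER) E.
Proof.
move=> zG sD revL revR E /revL [K [K_in endK GK]]; exists K; split=> //.
apply: zform_ge => //; first exact: zero_ropt zG GK.
move=> F /revR [KF [KF_in _ GKF]]; exists KF => //; apply: ge_trans GK.
by rewrite -[G]conjK; apply: ge_conj.
Qed.

(** The end-reversible subpositions of [G] and of [conj G] serve as the Left and, conjugated, the
    Right replacements. *)
Lemma Lstrong_star_hat5 G : U G ->
  (forall y, essential G y -> ge 0 y) -> (forall y, essential (conj G) y -> ge 0 y) ->
  ess_zero G -> ess_zero (conj G) -> Lstrong G -> Lstrong (conj G) -> hat5.
Proof.
move=> UG essG essG' zG zG' sG sG'.
have nendG : ~~ left_end G by case: zG => y /essential_nend.
have nendG' : ~~ left_end (conj G) by case: zG' => y /essential_nend.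
have [EL [nEL EL_ok winEL]] := end_rev_seq UG essG nendG sG.
have [ER [nER ER_ok winER]] := end_rev_seq (UC UG) essG' nendG' sG'.
apply: (@hat_zform EL ER) => // E.
- by case/EL_ok.
- by case/ER_ok.
- apply: (zform_end_rev zG'); first exact: Lstrong_zform.
    by move=> F /EL_ok [].
  by move=> F /ER_ok [].
apply: (@zform_end_rev (conj G)); first by rewrite conjK.
- exact: Lstrong_zform.
- by move=> F /ER_ok [].
by move=> F /EL_ok []; rewrite conjK.
Qed.

Lemma ge_add_lw1 A B G H X : U A -> U H -> U X -> ge A G -> ge B H ->
  lw1 (G ⊕ (H ⊕ X)) -> lw1 (A ⊕ (B ⊕ X)).
Proof.
move=> UA UH UX AG BH /(ge_lw1 AG (UD UH UX)).
rewrite addgA lw1_swap -addgA => /(ge_lw1 BH (UD UA UX)).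
by rewrite addgA lw1_swap -addgA.
Qed.

Lemma Nlw1_star_star S : left_end S -> starkiller S -> ~~ lw1 (star ⊕ (star ⊕ S)).
Proof.
move=> endS skS; apply: Nlw1P; first by rewrite left_end_add.
have nw := Nlw2_starkiller (or_introl skS).
move=> x /lopts_addP [] [y].
  by rewrite inE => /eqP -> ->; rewrite add0g.
case/lopts_addP=> -[z z_in -> ->]; last by case: (left_endP endS z_in).
by move: z_in; rewrite inE => /eqP ->; rewrite add0g.
Qed.

Lemma star_star_absurd G H : U G -> U H -> ge (G ⊕ H) 0 -> ge star G -> ge star H ->
  (exists S, [/\ U S, left_end S & starkiller S]) -> False.
Proof.
move=> UG UH GH0 sG sH [S [US endS skS]].
have /negP [] := Nlw1_star_star endS skS.
by apply: ge_add_lw1 sG sH _ => //; apply: sum_ge0_lw1.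
Qed.

(** Right moves to the witness [r]. A Left move to 0 loses there at once; a Left move to a
    replacement is met by its Left end, after which [Nlw2_disintegrator] applies; a Left move in [r]
    falls under the induction. *)
Lemma Nlw2_zform EL S : (forall E, E \in EL -> U E) ->
  (forall E, E \in EL -> exists2 K, K \in ropts E &
     left_end K /\ exists2 k, k \in ropts K & ge 0 k) ->
  U S -> super_starkiller S \/ ~~ lw1 S -> ~~ lw2 (zform EL [::] ⊕ S).
Proof.
move=> UEL revEL; have [n] := ubnP (gsize S); elim: n S => // n IH S lt_n US.
case=> [[r r_in nend wr wl]|nw]; last first.
  by apply: (Nlw2_opt (in_ropts_addl (G := zform EL [::]) S (mem_head _ _))); rewrite add0g.
apply: (Nlw2_opt (in_ropts_addr _ r_in)); apply: Nlw1P.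
  by rewrite left_end_add (negPf nend) andbF.
have Ur' := Ur US r_in.
move=> x /lopts_addP [] [l l_in ->].
  move: l_in; rewrite inE => /orP [/eqP ->|E_in]; first by rewrite add0g; apply: Nlw2_oR.
  have [K K_in [endK [k k_in k0]]] := revEL l E_in.
  apply: (Nlw2_opt (in_ropts_addl r K_in)); apply: Nlw1P.
    by rewrite left_end_add (negPf nend) andbF.
  move=> y /lopts_addP [] [v v_in ->]; first by case: (left_endP endK v_in).
  apply: (Nlw2_disintegrator endK k_in k0 (Ul Ur' v_in)).
  by case: (wl v v_in) => [/Nlw1_oL|/super_starkillerW []]; auto.
apply: IH; first by have := gsize_lopt l_in; have := gsize_ropt r_in; lia.
  exact: Ul Ur' l_in.
by case: (wl l l_in) => [/Nlw1_oL|]; auto.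
Qed.

(** [G] is bounded by an expansion [D] of the form with one tombstone, and [H] by [star]. The super
    starkiller [S] then makes Left lose [D ⊕ (star ⊕ S)] moving first, which [G ⊕ H >= 0]
    forbids. *)
Lemma strong_weak_star_absurd G H : U G -> U H -> ge (G ⊕ H) 0 ->
  (forall y, essential G y -> ge 0 y) -> ess_zero G -> ess_zero (conj G) ->
  Lstrong G -> ge star H ->
  (hat3 -> exists S, [/\ U S, left_end S & super_starkiller S]) -> False.
Proof.
move=> UG UH GH0 essG zG zG' sG sH cond3.
have nendG : ~~ left_end G by case: zG => y /essential_nend.
have [EL [nEL EL_ok winEL]] := end_rev_seq UG essG nendG sG.
have UEL E : E \in EL -> U E by case/EL_ok.
pose D := zform EL [::].
have sD : Lstrong D by exact: Lstrong_zform.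
have UD' : U D by exact: U_zform.
have [|S [US endS ssS]] := cond3.
  apply: (@hat_zform_l EL) => //; apply: (zform_end_rev zG') => // E.
  by case/EL_ok.
have DG : ge D G.
  apply: chain_le => // [y /essG le0|x]; first by exists 0; rewrite ?mem_head.
  by rewrite inE => /eqP ->; apply: zero_right.
have revEL E : E \in EL -> exists2 K, K \in ropts E &
    left_end K /\ exists2 k, k \in ropts K & ge 0 k.
  case/EL_ok=> _ [K [K_in endK GK]]; exists K => //; split=> //.
  exact: zero_ropt zG' GK.
have: lw1 (D ⊕ (star ⊕ S)).
  by apply: ge_add_lw1 DG sH _ => //; apply: sum_ge0_lw1.
have [dS skS] := super_starkillerW ssS.
apply/negP; apply: Nlw1P; first by rewrite left_end_add.
move=> x /lopts_addP [] [y y_in ->].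
  move: y_in; rewrite inE => /orP [/eqP ->|E_in].
    by rewrite add0g; apply: Nlw2_starkiller; left.
  have [K K_in [endK [k k_in k0]]] := revEL y E_in.
  apply: (Nlw2_opt (in_ropts_addl _ K_in)); apply: Nlw1P.
    by rewrite !left_end_add andbF.
  move=> u /lopts_addP [] [v v_in ->]; first by case: (left_endP endK v_in).
  case/lopts_addP: v_in => -[{}v v_in ->]; last by case: (left_endP endS v_in).
  move: v_in; rewrite inE => /eqP ->; rewrite add0g.
  by apply: (Nlw2_disintegrator endK k_in k0 US); left.
case/lopts_addP: y_in => -[v v_in ->]; last by case: (left_endP endS v_in).
move: v_in; rewrite inE => /eqP ->; rewrite add0g.
by apply: Nlw2_zform => //; left.
Qed.

Lemma reduced_of_conditions :
  (exists S, [/\ U S, left_end S & starkiller S]) ->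
  (hat3 -> exists S, [/\ U S, left_end S & super_starkiller S]) ->
  ~ hat5 ->
  forall G H, U G -> U H -> ge (G ⊕ H) 0 -> ge 0 (G ⊕ H) -> ge 0 G /\ ge G 0.
Proof.
move=> cond2 cond3 cond5 G H; have [n] := ubnP (gsize G + gsize H)%N.
elim: n G H => // n IH G H lt_n UG UH GH0 GH0'.
have UcG := UC UG; have UcH := UC UH.
have HG0 : ge (H ⊕ G) 0 by apply: ge_trans (geC _ _) _.
have HG0' : ge 0 (H ⊕ G) by apply: ge_trans (geC _ _).
have IH' A B : U A -> U B -> (gsize A + gsize B <= gsize G + gsize H)%N ->
    forall y h, essential A y -> essential (conj B) h ->
    ge 0 (y ⊕ conj h) -> ge (y ⊕ conj h) 0 -> ge 0 y /\ ge y 0.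
  move=> UA UB le_AB y h ess_y ess_h le0 ge0; apply: (IH y (conj h)) => //.
  - have := essential_size ess_y; have := essential_size ess_h.
    by rewrite !gsize_conj; lia.
  - exact: essential_U ess_y.
  - by apply: UC; apply: essential_U ess_h; apply: UC.
(* Stated for arbitrary [A] and [B], since it is needed for [G], [H] and their conjugates. Paired
   sides have essential options together, and then each has one equivalent to 0. *)
have le0 A B : U A -> U B -> ge (A ⊕ B) 0 -> ge 0 (A ⊕ B) ->
    (gsize A + gsize B <= gsize G + gsize H)%N ->
    (forall y, essential A y -> ge 0 y) /\
    ((forall y, ~ essential A y) /\ (forall y, ~ essential (conj B) y) \/
     ess_zero A /\ ess_zero (conj B)).
  move=> UA UB AB0 AB0' le_AB; have UcA := UC UA; have UcB := UC UB.
  have cBA0 : ge (conj B ⊕ conj A) 0 by apply: ge_trans (geC _ _) (ge0_conj AB0').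
  have cBA0' : ge 0 (conj B ⊕ conj A) by apply: ge_trans (conj_ge0 AB0) (geC _ _).
  have le_BA : (gsize (conj B) + gsize (conj A) <= gsize G + gsize H)%N.
    by rewrite !gsize_conj; lia.
  have essA := essential_le0 UA UB AB0 AB0' (IH' A B UA UB le_AB).
  have essB := essential_le0 UcB UcA cBA0 cBA0' (IH' _ _ UcB UcA le_BA).
  split; first by move=> y /essA [].
  case: (classic (exists y, essential A y)) => [[y ess_y]|noA].
    right; split; first by case: (essA y ess_y).
    have [h ess_h _] := essential_pair UA UB AB0 AB0' ess_y.
    by case: (essB h ess_h).
  left; split=> [y ess_y|h ess_h]; first by apply: noA; exists y.
  have [y] := essential_pair UcB UcA cBA0 cBA0' ess_h.
  by rewrite conjK => ess_y _; apply: noA; exists y.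
have [essG dG] := le0 G H UG UH GH0 GH0' (leqnn _).
have le_HG : (gsize H + gsize G <= gsize G + gsize H)%N by rewrite addnC.
have [essH _] := le0 H G UH UG HG0 HG0' le_HG.
have cGH0 := ge0_conj GH0'; have cGH0' := conj_ge0 GH0.
have le_c : (gsize (conj G) + gsize (conj H) <= gsize G + gsize H)%N.
  by rewrite !gsize_conj.
have [essG' dG'] := le0 _ _ UcG UcH cGH0 cGH0' le_c.
have [essH' _] := le0 _ _ UcH UcG (ge_trans (geC _ _) cGH0)
  (ge_trans cGH0' (geC _ _)) (leq_trans (eq_leq (addnC _ _)) le_c).
rewrite conjK in dG'.
have le_zero A : (forall y, ~ essential A y) -> (forall y, ~ essential (conj A) y) -> ge 0 A.
  move=> noA noA'; apply: chain_le => // [y /noA //|_|_].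
    exact: Lstrong_end.
  exact: Lstrong_noess.
(* According to which sides of [G] contain a zero, [G] looks like 0, -1, 1 or star, up to
   tombstones. *)
case: dG => [[noG noH']|[zG zH']]; case: dG' => [[noG' noH]|[zG' zH]].
- have G0 := le_zero G noG noG'; have H0 := le_zero H noH noH'.
  split=> //; apply: ge_trans GH0; rewrite -[X in ge X _]addg0; exact: ge_addl.
- exfalso; case: (classic (Lstrong H)) => sH; last first.
    by apply: (@weak_one_absurd H G).
  exact: (@Lstrong_one_absurd H).
- exfalso; case: (classic (Lstrong G)) => sG; last first.
    by apply: (@weak_one_absurd G H).
  exact: (@Lstrong_one_absurd G).
exfalso.
have notG : Lstrong G -> ~ Lstrong (conj G).
  by move=> sG sG'; apply: cond5; apply: (@Lstrong_star_hat5 G).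
have notH : Lstrong H -> ~ Lstrong (conj H).
  by move=> sH sH'; apply: cond5; apply: (@Lstrong_star_hat5 H).
have zcG : ess_zero (conj (conj G)) by rewrite conjK.
have zcH : ess_zero (conj (conj H)) by rewrite conjK.
(* If both are strong, their conjugates are not, and these are bounded by [star]; if neither is, [G]
   and [H] are so bounded. The mixed cases have one tombstone. *)
case: (classic (Lstrong G)) => sG; case: (classic (Lstrong H)) => sH.
- have sG' := notG sG; have sH' := notH sH.
  by apply: (star_star_absurd UcG UcH cGH0) cond2; apply: ge_star.
- by apply: (@strong_weak_star_absurd G H) => //; apply: ge_star.
- by apply: (@strong_weak_star_absurd H G) => //; apply: ge_star.
by apply: (star_star_absurd UG UH GH0) cond2; apply: ge_star.
Qed.

(** * Necessity of the disintegrator and starkiller conditions *)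

Lemma lw2_neg1 Z : lw1 Z -> ~ disintegrator Z -> lw2 (neg1 ⊕ Z).
Proof.
have [n] := ubnP (gsize Z); elim: n Z => // n IH Z lt_n w nd.
apply/lw2P; split; first by rewrite right_end_add.
move=> x /ropts_addP [] [r r_in ->].
  by move: r_in; rewrite inE => /eqP ->; rewrite add0g.
case: (boolP (left_end r)) => endr; first by apply: lw1_end; rewrite left_end_add.
(* A Right move to [r] that Left could not answer would make [r] a witness that [Z] is a
   disintegrator. *)
apply: NNPP => no; apply: nd; apply: (Disintegrator r_in endr) => l l_in.
case: (classic (disintegrator l)) => ndl; [by right|left].
case E : (oL l) => //; case: no; apply: (lw1_opt (in_lopts_addr neg1 l_in)).
apply: IH ndl; first by have := gsize_lopt l_in; have := gsize_ropt r_in; lia.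
by rewrite /lw1 E.
Qed.

Lemma lw2_star Z : lw1 Z -> ~ starkiller Z -> lw2 (star ⊕ Z).
Proof.
have [n] := ubnP (gsize Z); elim: n Z => // n IH Z lt_n w nd.
apply/lw2P; split; first by rewrite right_end_add.
move=> x /ropts_addP [] [r r_in ->].
  by move: r_in; rewrite inE => /eqP ->; rewrite add0g.
apply: NNPP => no; apply: nd; apply: (Starkiller r_in) => [|l l_in].
  case E : (oR r) => //; case: no.
  by apply: (lw1_opt (in_lopts_addl (G := star) r (mem_head _ _))); rewrite add0g /lw2 E.
case: (classic (starkiller l)) => ndl; [by right|left].
case E : (oL l) => //; case: no; apply: (lw1_opt (in_lopts_addr star l_in)).
apply: IH ndl; first by have := gsize_lopt l_in; have := gsize_ropt r_in; lia.
by rewrite /lw1 E.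
Qed.

(** Strength of [G] handles the Left ends [r]; any other [r] without an answer would witness a super
    starkiller. *)
Lemma lw2_Lstrong G Z : Lstrong G -> ropts G = [:: 0] -> 0 \in lopts G ->
  U Z -> lw1 Z -> ~ super_starkiller Z -> lw2 (G ⊕ Z).
Proof.
move=> sG RG LG; have [n] := ubnP (gsize Z); elim: n Z => // n IH Z lt_n UZ w nd.
apply/lw2P; split; first by rewrite right_end_add /right_end RG.
move=> x /ropts_addP [] [r r_in ->].
  by move: r_in; rewrite RG inE => /eqP ->; rewrite add0g.
case: (boolP (left_end r)) => endr; first by apply: sG => //; apply: Ur UZ r_in.
apply: NNPP => no; apply: nd; apply: (SuperStarkiller r_in endr) => [|l l_in].
  case E : (oR r) => //; case: no.
  by apply: (lw1_opt (in_lopts_addl r LG)); rewrite add0g /lw2 E.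
case: (classic (super_starkiller l)) => ndl; [by right|left].
case E : (oL l) => //; case: no; apply: (lw1_opt (in_lopts_addr G l_in)).
apply: IH ndl; first by have := gsize_lopt l_in; have := gsize_ropt r_in; lia.
  exact: Ul (Ur UZ r_in) l_in.
by rewrite /lw1 E.
Qed.

Lemma ge_add_conj G :
  (forall r, r \in ropts G -> exists2 l, l \in lopts (r ⊕ conj G) & ge l 0) ->
  (forall l, l \in lopts G -> exists2 m, m \in lopts (G ⊕ conj l) & ge m 0) ->
  Lstrong (G ⊕ conj G) -> ge (G ⊕ conj G) 0.
Proof.
move=> repR repL sG; apply: ge_suff => // [r|_]; last exact: Lstrong_end.
case/ropts_addP=> -[x x_in ->]; right; first exact: repR.
by move: x_in; rewrite ropts_conj => /mapP [l l_in ->]; apply: repL.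
Qed.

(** Conjugating the inequality gives the opposite one, so it alone makes [G] invertible. *)
Lemma reduced_conj G : reduced U -> U G -> ge (G ⊕ conj G) 0 -> ge G 0 /\ ge 0 G.
Proof.
move=> red UG G0; have [|/game_geE ? /game_geE ?] := red G UG; last by [].
exists (conj G); split; first exact: UC.
split; apply/game_geE => //.
have := ge_conj G0; rewrite conj_add conjK => ?.
exact: (@ge_trans _ (conj G ⊕ G)) (geC _ _).
Qed.

Lemma reduced_disintegrator : reduced U -> U game1 ->
  exists G, [/\ U G, left_end G & disintegrator G].
Proof.
move=> red U1; apply: NNPP => no.
(* Moving first, Left wins 0 but loses 1, so [game1 >= 0] is absurd. *)
have [|g10 _] := @reduced_conj game1 red U1; last by have [/(_ isT)] := g10 0 U0.
apply: ge_add_conj => // [l|X UX endX].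
  by rewrite inE => /eqP ->; exists (0 ⊕ 0).
apply: (lw1_opt (in_lopts_addl X (g := 0 ⊕ neg1) _)) => //.
rewrite add0g; apply: lw2_neg1; first exact: lw1_end.
by move=> dX; apply: no; exists X.
Qed.

Lemma reduced_starkiller : reduced U ->
  exists G, [/\ U G, left_end G & starkiller G].
Proof.
move=> red; apply: NNPP => no.
have [|g10 _] := @reduced_conj star red U_star; last by have [/(_ isT)] := g10 0 U0.
apply: ge_add_conj => // [r|l|X UX endX].
- by rewrite inE => /eqP ->; exists 0; rewrite ?add0g ?mem_head.
- by rewrite inE => /eqP ->; exists 0; rewrite ?addg0 ?mem_head.
apply: (lw1_opt (in_lopts_addl X (g := 0 ⊕ star) _)) => //.
rewrite add0g; apply: lw2_star; first exact: lw1_end.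
by move=> dX; apply: no; exists X.
Qed.

(** * Necessity of the conditions on tombstone forms *)

Lemma nil_of_false (T : eqType) (s : seq T) : false = (s != [::]) -> s = [::].
Proof. by case: s. Qed.

Lemma expansion0P g : expansion U (aform_of 0) g -> g = 0.
Proof.
move=> exp; inversion exp as [lt rt LA RA L R EL ER FL FR eEL eER revL revR]; subst.
by inversion FL; inversion FR; rewrite (nil_of_false eEL) (nil_of_false eER).
Qed.

Lemma expansion_zerosP n L :
  List.Forall2 (expansion U) (nseq n (aform_of 0)) L -> L = nseq n 0.
Proof.
elim: n L => [|n IH] L FL; inversion FL as [|a g s t eg et]; subst => //=.
by rewrite (expansion0P eg) (IH t et).
Qed.

(** One inversion for all four augmented forms of the theorem; [n] is 0 or 1 there. *)
Lemma hat_zerosP n lt rt :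
  hat U (AForm lt [:: aform_of 0] (nseq n (aform_of 0)) rt) ->
  exists EL ER,
    let G := Game (0 :: EL) (nseq n 0 ++ map conj ER) in
    [/\ U G, lt = (EL != [::]), rt = (ER != [::]),
        forall E, E \in EL -> end_rev G E &
        forall E, E \in ER -> end_rev (conj G) E].
Proof.
case=> G [UG exp].
inversion exp as [lt' rt' LA RA L R EL ER FL FR eEL eER revL revR]; subst.
have eL : L = [:: 0] by exact: (@expansion_zerosP 1).
have eR := expansion_zerosP FR; subst.
exists EL, (map conj ER); rewrite -map_comp (eq_map conjK) map_id; split=> //.
- by case: (ER).
- by move=> E /revL /end_revE.
move=> _ /mapP [E /revR [K [K_in endK geK]] ->]; exists (conj K); split.
- exact: conj_lopt.
- by rewrite left_end_conj.
exact/ge_conj/game_geE.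
Qed.

Lemma reduced_hat3 : reduced U -> hat3 ->
  exists S, [/\ U S, left_end S & super_starkiller S].
Proof.
move=> red /(@hat_zerosP 1) [EL [ER [UG]]] nEL /nil_of_false eER revL _.
apply: NNPP => no.
move: UG revL; rewrite {}eER /=; set G := Game _ _ => UG revL.
have [E0 E0_in] := seq_neq0 nEL.
have sG : Lstrong G.
  have [K [_ endK GK]] := revL _ E0_in; exact: Lstrong_ge GK (Lstrong_end endK).
have winG X : U X -> left_end X -> lw2 (G ⊕ X).
  move=> UX endX; apply: (lw2_Lstrong sG) => //; first exact: lw1_end.
  by move=> ssX; apply: no; exists X.
(* [G >= 0] fails: Right's option 0 can be neither matched in 0 nor reversed. *)
have [|g10 _] := @reduced_conj G red UG; last first.
  by case: (ge_ropt g10 (mem_head 0 _) (ge_refl 0)) => -[].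
apply: ge_add_conj => [r|l|X UX endX].
- by rewrite inE => /eqP ->; exists 0 => //; rewrite add0g; exact: mem_head.
- rewrite inE => /orP [/eqP ->|l_in].
    by exists 0 => //; rewrite addg0; exact: mem_head.
  have UE : U l by apply: Ul UG _; rewrite inE l_in orbT.
  have [K [K_in endK GK]] := revL l l_in.
  have [[k k_in k0]|[]//] := ge_ropt GK (mem_head 0 _) (ge_refl 0).
  (* Left meets the move to [conj l] by its reversing end. Afterwards [conj k >= 0] answers Right's
     move of [G] to 0, and is Left's winning first move beside a Left end. *)
  exists (G ⊕ conj K); first by apply: in_lopts_addr; apply: conj_ropt.
  have ck_in := conj_ropt k_in; have ck0 : ge (conj k) 0 := ge_conj k0.
  apply: ge_suff => // [r|_|_]; last exact: Lstrong_end.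
    case/ropts_addP=> -[x x_in ->].
      move: x_in; rewrite inE => /eqP ->; right; exists (conj k) => //.
      by rewrite add0g.
    by move: x_in; rewrite ropts_conj => /mapP [y /(left_endP endK)].
  move=> X UX endX; apply: (lw1_opt (in_lopts_addl X (in_lopts_addr G ck_in))).
  apply: (@ge_lw2 _ G) (winG X UX endX) => //.
  by rewrite -[X in ge _ X]addg0; apply: ge_addl.
apply: (lw1_opt (in_lopts_addl X (g := G ⊕ 0) _)); last by rewrite addg0; apply: winG.
by apply: in_lopts_addr; exact: mem_head.
Qed.

Lemma reduced_hat4 : reduced U ->
  ~ hat U (AForm true [:: aform_of 0] [::] false).
Proof.
move=> red /(@hat_zerosP 0) [EL [ER [UG]]] nEL /nil_of_false eER revL _.
move: UG revL; rewrite {}eER /=; set G := Game _ _ => UG revL.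
have [E0 E0_in] := seq_neq0 nEL.
have sG : Lstrong G.
  have [K [_ endK GK]] := revL _ E0_in; exact: Lstrong_ge GK (Lstrong_end endK).
have G0 : ge G 0 by apply: ge_suff => // _; apply: Lstrong_end.
(* [0 >= G] fails, since Left's option 0 has no Right response. *)
have [|_ g01] := @reduced_conj G red UG; last first.
  by case: (ge0_lopt g01 (mem_head 0 _)).
apply: ge_add_conj => [r|l|X UX endX] //.
  rewrite inE => /orP [/eqP ->|l_in].
    by exists 0 => //; rewrite addg0; exact: mem_head.
  have [K [K_in endK GK]] := revL l l_in.
  exists (G ⊕ conj K); first by apply: in_lopts_addr; apply: conj_ropt.
  apply: ge_add_ge0 => //; apply: (@ge_conj 0); apply: le0_left_end => //.
  by apply: Lstrong_ge (ge_conj GK) _; apply: Lstrong_end.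
by rewrite -addgA; apply: sG; [apply: UD => //; apply: UC|rewrite left_end_add endX].
Qed.

Definition end_rev_or0 G l := l = 0 \/ end_rev G l.

(** The bound [K'] makes [conj G] strong, hence [K <= 0]. Left answers Right's move to 0 by
    [conj k], and an end-reversible move by reversing it, which leaves a sum of two games [>= 0]. *)
Lemma ge_add_conj_end G K K' : U G -> 0 \in ropts G ->
  (forall r, r \in ropts G -> end_rev_or0 (conj G) (conj r)) ->
  left_end K -> U K -> ge G K -> left_end K' -> ge (conj G) K' -> ge (G ⊕ conj K) 0.
Proof.
move=> UG G_0 revR endK UK GK endK' GK'.
have sK : ge 0 K.
  apply: le0_left_end => //; apply: Lstrong_ge (ge_conj GK) _.
  exact: Lstrong_ge GK' (Lstrong_end endK').
have cK0 : ge (conj K) 0 := ge_conj sK.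
have [[k k_in k0]|[]//] := ge_ropt GK G_0 (ge_refl 0).
have sG : Lstrong G := Lstrong_ge GK (Lstrong_end endK).
apply: ge_suff => // [r|_|_]; last exact: Lstrong_end.
  case/ropts_addP=> -[x x_in ->]; last first.
    by move: x_in; rewrite ropts_conj => /mapP [y /(left_endP endK)].
  have Ux := Ur UG x_in; right.
  case: (revR x x_in) => [x0|[J [J_in endJ GJ]]].
    exists (x ⊕ conj k); first by apply: in_lopts_addr; apply: conj_ropt.
    by rewrite -[x]conjK x0 add0g; apply: (@ge_conj 0).
  have cJ_in : conj J \in lopts x by rewrite -[x]conjK; apply: conj_ropt.
  exists (conj J ⊕ conj K); first exact: in_lopts_addl.
  apply: ge_add_ge0 => //; first exact: Ul Ux cJ_in.
  apply: (@ge_conj 0); apply: le0_left_end => //; apply: Lstrong_ge sG.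
  by rewrite -[G]conjK; apply: ge_conj.
apply: Lstrong_ge sG; rewrite -[X in ge _ X]addg0; exact: ge_addl.
Qed.

(** Left answers a move to 0 by moving the other summand to 0, and an end-reversible move by its
    reversing end, which [ge_add_conj_end] handles. *)
Lemma ge_add_conj_daggers G K K' : U G -> 0 \in lopts G -> 0 \in ropts G ->
  (forall l, l \in lopts G -> end_rev_or0 G l) ->
  (forall r, r \in ropts G -> end_rev_or0 (conj G) (conj r)) ->
  left_end K -> U K -> ge G K -> left_end K' -> U K' -> ge (conj G) K' ->
  ge (G ⊕ conj G) 0.
Proof.
move=> UG G0_ G_0 revL revR endK UK GK endK' UK' GK'.
have cG0_ : 0 \in lopts (conj G) := conj_ropt G_0.
have cG_0 : 0 \in ropts (conj G) := conj_lopt G0_.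
apply: ge_add_conj => [r r_in|l l_in|X UX endX].
- case: (revR r r_in) => [r0|[J [J_in endJ GJ]]].
    by exists 0; rewrite // -[r]conjK r0 add0g.
  have cJ_in : conj J \in lopts r by rewrite -[r]conjK; apply: conj_ropt.
  exists (conj J ⊕ conj G); first exact: in_lopts_addl.
  apply: ge_trans (geC _ _) _; apply: (@ge_add_conj_end _ _ K) => //; rewrite ?conjK //.
  + exact: UC.
  + by rewrite ropts_conj => y /mapP [l l_in ->]; rewrite conjK; apply: revL.
  by rewrite -[J]conjK; apply: UC; apply: Ul (Ur UG r_in) cJ_in.
- case: (revL l l_in) => [->|[J [J_in endJ GJ]]]; first by exists 0; rewrite ?addg0.
  exists (G ⊕ conj J); first by apply: in_lopts_addr; apply: conj_ropt.
  apply: (@ge_add_conj_end _ _ K') => //; exact: Ur (Ul UG l_in) J_in.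
apply: (@ge_lw1 _ (G ⊕ K')) => //; first exact: ge_addl.
rewrite -addgA; apply: (Lstrong_ge GK (Lstrong_end endK)); first exact: UD.
by rewrite left_end_add endK'.
Qed.

Lemma reduced_hat5 : reduced U -> ~ hat5.
Proof.
move=> red /(@hat_zerosP 1) [EL [ER [UG]]] nEL nER; move: UG.
set G := Game _ _ => UG revL revR.
have [E E_in] := seq_neq0 nEL.
have [F F_in] := seq_neq0 nER.
have [K [K_in endK GK]] := revL E E_in; have [K' [K'_in endK' GK']] := revR F F_in.
have UE : U E by apply: Ul UG _; rewrite inE E_in orbT.
have UF : U F.
  rewrite -[F]conjK; apply: UC; apply: Ur UG _.
  by rewrite inE; apply/orP; right; apply: map_f.
have [|g10 _] := @reduced_conj G red UG; last first.
  by case: (ge_ropt g10 (mem_head 0 _) (ge_refl 0)) => -[].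
apply: (@ge_add_conj_daggers G K K') => //; try exact: mem_head.
- by move=> l; rewrite inE => /orP [/eqP ->|/revL]; [left|right].
- move=> r; rewrite inE => /orP [/eqP ->|/mapP [J /revR revJ ->]]; first by left.
  by right; rewrite conjK.
- exact: Ur UE K_in.
exact: Ur UF K'_in.
Qed.

End Universe.

Theorem theorem4p13 (U : game -> Prop) (hU : universe U) :
  reduced U <->
  [/\ (hat U (aform_of game1) ->
         exists G, [/\ U G, left_end G & disintegrator G]),
      (exists G, [/\ U G, left_end G & starkiller G]),
      (hat U (AForm true [:: aform_of game0] [:: aform_of game0] false) ->
         exists G, [/\ U G, left_end G & super_starkiller G]),
      ~ hat U (AForm true [:: aform_of game0] [::] false) &
      ~ hat U (AForm true [:: aform_of game0] [:: aform_of game0] true)].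
Proof.
split=> [red|[_ cond2 cond3 _ cond5] G UG [H [UH [/game_geE GH0 /game_geE GH0']]]].
  split.
  (* Without tombstones the only expansion is the form itself, so [game1] lies in [U]. *)
  - move=> /(@hat_zerosP _ hU 0) [EL [ER [U1]]] /nil_of_false eEL /nil_of_false eER _ _.
    by apply: reduced_disintegrator => //; move: U1; rewrite eEL eER.
  - exact: reduced_starkiller.
  - exact: reduced_hat3.
  - exact: reduced_hat4.
  - exact: reduced_hat5.
have [G0 G0'] := reduced_of_conditions hU cond2 cond3 cond5 UG UH GH0 GH0'.
by split; apply/game_geE.
Qed.
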